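(* Let $S_i(t)=r_it+B_i(t)$, $i=1,\dots,d$, where $r_i\in\mathbb R$ and $\boldsymbol B=(B_1,\dots,B_d)^\top$ is a $d$-dimensional Brownian motion with zero drift and $\mathbb E[\boldsymbol B(t)\boldsymbol B(t)^\top]=\boldsymbol\Sigma t$, $\boldsymbol\Sigma=(\sigma_{i,j}^2)_{i,j}$. Put $S=\sum_{i=1}^d S_i$, $r=\sum_{i=1}^d r_i$ and $\sigma^2=\sum_{i,j=1}^d\sigma_{i,j}^2$, assumed strictly positive, and suppose $r<0$. Let $\alpha\in(0,1)$. Then $\mathrm{VaR}^\alpha(S,\infty)=\frac{\sigma^2}{2r}\ln\alpha$, and for every $i\in\{1,\dots,d\}$ the gradient allocation $\mathrm{GVaR}_i^\alpha(S,\infty)$ exists, coincides with the allocation $\mathrm{AVaR}_i^\alpha(S,\infty)$, and $$\frac{\mathrm{GVaR}_i^\alpha(S,\infty)}{\mathrm{VaR}^\alpha(S,\infty)}=\frac{\mathrm{AVaR}_i^\alpha(S,\infty)}{\mathrm{VaR}^\alpha(S,\infty)}=\frac{2\sum_{j=1}^d\sigma_{i,j}^2}{\sigma^2}-\frac{r_i}{r}.$$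
   Context: $d\ge2$. The symbol $\sigma_{i,j}^2$ denotes the $(i,j)$ entry of the covariance matrix $\boldsymbol\Sigma$ (it may be negative for $i\neq j$). For a real-valued process $R$, $\mathrm{VaR}^\alpha(R,\infty)=\inf\{u\ge0:\mathbb P(\sup_{t\in[0,\infty)}R(t)\ge u)\le\alpha\}$. Gradient allocation: $\mathrm{GVaR}_i^\alpha(S,\infty)=\frac{\partial}{\partial x_i}\mathrm{VaR}^\alpha\big(\sum_{j\ne i}S_j+x_iS_i,\infty\big)\Big|_{x_i=1}$. Allocation at the time of ruin: with $\tau(u)=\inf\{t\ge0:S(t)\ge u\}$, $$K_i(u,S,\infty)=u\,\frac{\mathbb E[S_i(\tau(u))\mid\tau(u)<\infty]}{\mathbb E[S(\tau(u))\mid\tau(u)<\infty]},\qquad \mathrm{AVaR}_i^\alpha(S,\infty)=K_i(\mathrm{VaR}^\alpha(S,\infty),S,\infty).$$ *)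

(* Defs.v *)
From HB Require Import structures.
From mathcomp Require Import all_boot all_order all_algebra.
From mathcomp Require Import all_classical all_reals all_analysis.
Set Implicit Arguments.
Unset Strict Implicit.
Unset Printing Implicit Defensive.
Import Order.TTheory GRing.Theory Num.Theory.
Import numFieldNormedType.Exports.
Local Open Scope classical_set_scope.
Local Open Scope ring_scope.

Section Probability.
Context (R : realType) (disp : measure_display) (T : measurableType disp).
Variable P : probability T R.

(* The index type is finite, so subfamilies are covered by taking [A k = setT]
   for the omitted indices. *)
Definition mutually_independent (disp' : measure_display)
    (U : measurableType disp') (I : finType) (X : I -> T -> U) : Prop :=
  forall A : I -> set U, (forall k, measurable (A k)) ->
    P (\bigcap_(k in [set: I]) (X k @^-1` A k)) =
      (\prod_(k : I) P (X k @^-1` A k))%E.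

(* [normal_prob m s] (mean [m], standard deviation [s]) is not the point mass
   at [m] when [s = 0], hence the case distinction. *)
Definition normal_law (m s : R) : set R -> \bar R :=
  if s == 0 then \d_m else normal_prob m s.

(* Every linear combination of the coordinates is univariate normal, possibly
   degenerate; the covariance matrix [C] may be singular. *)
Definition gaussian_vector (d : nat) (m : 'cV[R]_d) (C : 'M[R]_d)
    (X : 'I_d -> T -> R) : Prop :=
  [/\ forall a : 'I_d -> R, exists mu s : R, 0 <= s /\
        forall A : set R, measurable A ->
          P ((fun w => \sum_i a i * X i w) @^-1` A) = normal_law mu s A,
      forall i, ('E_P[X i] = (m i ord0)%:E)%E &
      forall i j, covariance P (X i) (X j) = (C i j)%:E].

(* A process is a function of time on all of [R], but only times [t >= 0] are
   ever constrained or used. *)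
Definition brownian_motion (d : nat) (Sigma : 'M[R]_d)
    (B : 'I_d -> R -> T -> R) : Prop :=
  [/\ forall i t, 0 <= t -> measurable_fun [set: T] (B i t),
      {ae P, forall w, forall i, B i 0 w = 0},
      forall i w, {within `[0, +oo[, continuous (fun t => B i t w)},
      forall (k : nat) (t : nat -> R), 0 <= t 0%N -> nondecreasing_seq t ->
        mutually_independent (fun (l : 'I_k) w =>
          [tuple B i (t l.+1) w - B i (t l) w | i < d]) &
      forall s t, 0 <= s -> s <= t ->
        gaussian_vector 0 ((t - s) *: Sigma)
          (fun i w => B i t w - B i s w)].

Definition path_sup (X : R -> T -> R) (w : T) : \bar R :=
  ereal_sup [set (X t w)%:E | t in [set t : R | 0 <= t]].

Definition VaR (alpha : R) (X : R -> T -> R) : \bar R :=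
  ereal_inf [set u%:E | u in
    [set u : R | 0 <= u /\
       (P [set w | (u%:E <= path_sup X w)%E] <= alpha%:E)%E]].

Definition hitting_time (X : R -> T -> R) (u : R) (w : T) : \bar R :=
  ereal_inf [set t%:E | t in [set t : R | 0 <= t /\ u <= X t w]].

Definition hits (X : R -> T -> R) (u : R) : set T :=
  [set w | (hitting_time X u w < +oo)%E].

Definition cond_expectation (A : set T) (X : T -> R) : \bar R :=
  (\int[P]_(w in A) (X w)%:E * ((fine (P A))^-1)%:E)%E.

Section Allocation.
Variables (d : nat) (S : 'I_d -> R -> T -> R).

Definition aggregate (t : R) (w : T) : R := \sum_(j < d) S j t w.

Definition reweighted (i : 'I_d) (x t : R) (w : T) : R :=
  \sum_(j < d | j != i) S j t w + x * S i t w.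

Definition GVaR (alpha : R) (i : 'I_d) : R :=
  derive1 (fun x => fine (VaR alpha (reweighted i x))) 1.

(* The finiteness requirement rules out differentiating values of [fine] at
   infinity. *)
Definition GVaR_exists (alpha : R) (i : 'I_d) : Prop :=
  (\forall x \near (1 : R), VaR alpha (reweighted i x) \is a fin_num) /\
  derivable (fun x => fine (VaR alpha (reweighted i x))) 1 1.

(* On [hits aggregate u] the hitting time is finite; elsewhere the value of
   [at_ruin] is irrelevant. *)
Definition at_ruin (u : R) (X : R -> T -> R) (w : T) : R :=
  X (fine (hitting_time aggregate u w)) w.

Definition Kalloc (i : 'I_d) (u : R) : R :=
  u * (fine (cond_expectation (hits aggregate u) (at_ruin u (S i))) /
       fine (cond_expectation (hits aggregate u) (at_ruin u aggregate))).

(* The conditional expectations in [Kalloc] exist and are finite, and the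
   denominator does not vanish. *)
Definition Kalloc_exists (i : 'I_d) (u : R) : Prop :=
  [/\ (0 < P (hits aggregate u))%E,
      P.-integrable (hits aggregate u) (EFin \o at_ruin u (S i)),
      P.-integrable (hits aggregate u) (EFin \o at_ruin u aggregate) &
      cond_expectation (hits aggregate u) (at_ruin u aggregate) != 0%E].

Definition AVaR (alpha : R) (i : 'I_d) : R := 
  Kalloc i (fine (VaR alpha aggregate)).

Definition AVaR_exists (alpha : R) (i : 'I_d) : Prop :=
  VaR alpha aggregate \is a fin_num /\ 
  Kalloc_exists i (fine (VaR alpha aggregate)).

End Allocation.
End Probability.

(* Main.v *)
Require Import Defs.
From HB Require Import structures.
From mathcomp Require Import all_boot all_order all_algebra.
From mathcomp Require Import all_classical all_reals all_analysis.
From mathcomp Require Import measurable_realfun.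
From mathcomp Require Import ring lra.

(** Write [psi th = th.r + (th.Sigma th) / 2], so that
    [exp (th.S(t) - psi th * t)] is a martingale for every vector [th]. Stopping
    it at the passage time [tau] of the aggregate process above [u] gives
      E [exp (th.S(tau) - psi th * tau); tau < oo] <= 1   for every [th],
    with equality at [th = c0 * (1, .., 1)], [c0 = - 2 r / sigma^2], where [psi]
    vanishes. Equality yields [P (tau < oo) = exp (- c0 u)], hence the value at
    risk, whose gradient is computed explicitly. As the left-hand side is
    maximal at [c0 * (1, .., 1)], its first-order variation in the direction of
    asset [i] vanishes there: E [S_i(tau); tau < oo] is
    [(r_i + c0 * sum_j Sigma i j) * E [tau; tau < oo]], and summing over [i]
    determines [E [tau; tau < oo]]. *)

Set Implicit Arguments.
Unset Strict Implicit.
Unset Printing Implicit Defensive.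
Import Order.TTheory GRing.Theory Num.Theory.
Import numFieldNormedType.Exports.
Local Open Scope classical_set_scope.
Local Open Scope ring_scope.

(** * Exponential moments of Gaussian vectors *)

(** No filtration is introduced: the martingale property is only an equality of expectations over
    events determined by finitely many Brownian increments, and stopping takes place along dyadic
    grids with a bounded horizon. Reaching the true passage time requires refining the grid and then
    raising the level towards [u]; both limits are taken by Fatou, so only the inequality survives.
    Equality at [c0 * (1, .., 1)] therefore needs a separate lower bound on the ruin probability. At
    a finite horizon [h] the expectation 1 is split; paths below [u] at time [h] contribute at most
    [expR (c0 * u / 2 + psi2 * h)], where [psi2] is the value of [psi] at [c0 / 2 * (1, .., 1)].
    Along this direction [psi] is a convex parabola with zeros 0 and [c0], so [psi2] is its minimum
    and is negative, and the contribution vanishes as [h] grows. The same negativity gives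
    exponential moments of [tau] and of [S_i(tau)] on the event of ruin, hence the integrability
    without which the allocation would be meaningless. *)

Lemma ge0_integral_normal_prob (R : realType) (m s : R) (f : R -> \bar R) :
  s != 0 -> (forall x, (0 <= f x)%E) -> measurable_fun [set: R] f ->
  (\int[normal_prob m s]_x f x =
   \int[lebesgue_measure]_x (f x * (normal_pdf m s x)%:E))%E.
Proof.
move=> s0 f0 mf.
have dom := normal_prob_dominates m s.
rewrite -(Radon_Nikodym_SigmaFinite.change_of_variables dom)//.
have mpdf : measurable_fun [set: R] (fun x => (normal_pdf m s x)%:E).
  by apply/measurable_EFinP; exact: measurable_normal_pdf.
have fint := Radon_Nikodym_SigmaFinite.f_integrable dom.
(* The density and the Radon-Nikodym derivative have the same integral over every measurable set, so
   they agree almost everywhere. *)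
apply: ae_eq_integral => //.
- by apply: emeasurable_funM => //; exact: measurable_int fint.
- exact: emeasurable_funM.
- apply: ae_eqe_mul2l => /=; apply: integral_ae_eq => //.
  by move=> E _ mE; rewrite -Radon_Nikodym_SigmaFinite.f_integral.
Qed.

(* Completing the square: the tilted density is again a normal density. *)
Lemma normal_pdf_tilt (R : realType) (m s a x : R) : s != 0 ->
  expR (a * x) * normal_pdf m s x =
  expR (a * m + a ^+ 2 * s ^+ 2 / 2) * normal_pdf (m + a * s ^+ 2) s x.
Proof.
move=> s0; rewrite !normal_pdfE// /normal_fun.
rewrite mulrCA [in RHS]mulrCA -!expRD; congr (_ * expR _).
by rewrite -mulr_natr; field.
Qed.

(** Squeeze: [1 + y <= expR y] at [y = x * b n] and at [y = - (x * b n)] bounds the slope between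
    [x] and [x * expR (x * b n)]. *)
Lemma cvg_expR_slope (R : realType) (x : R) (b : nat -> R) :
  (forall n, 0 < b n) -> b @ \oo --> (0 : R) ->
  (fun n => (expR (x * b n) - 1) / b n) @ \oo --> x.
Proof.
move=> b0 bcvg.
have xb : (fun n => x * b n) @ \oo --> (0 : R).
  by rewrite -[X in _ --> X](mulr0 x); apply: cvgM => //; exact: cvg_cst.
apply: (@squeeze_cvgr _ _ _ _ (cst x) (fun n => x * expR (x * b n))).
- apply: nearW => n; apply/andP; split.
    by rewrite ler_pdivlMr// lerBrDl expR_ge1Dx.
  rewrite ler_pdivrMr//.
  have := expR_ge1Dx (- (x * b n)).
  rewrite -(ler_pM2r (expR_gt0 (x * b n))) -expRD addNr expR0 mulrDl mul1r.
  by move=> h; lra.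
- exact: cvg_cst.
- rewrite -[X in _ --> X]mulr1; apply: cvgM; first exact: cvg_cst.
  rewrite -(expR0 R); apply: (@continuous_cvg _ _ _ _ _ _ (@expR R)) => //.
  exact: continuous_expR.
Qed.

(** This bound and the next one supply dominating functions built from exponentials, so that
    exponential moments yield ordinary ones. *)
Lemma normr_le_expRD (R : realType) (x : R) : `|x| <= expR x + expR (- x).
Proof.
have := expR_ge1Dx x; have := expR_ge1Dx (- x).
have := expR_gt0 x; have := expR_gt0 (- x).
by case: (ger0P x); lra.
Qed.

Lemma sqr_le_expRD (R : realType) (x : R) : x ^+ 2 <= 2 * (expR x + expR (- x)).
Proof.
wlog x0 : x / 0 <= x => [h|].
  have [/h//|/ltW x0] := leP 0 x.
  by have := h (- x); rewrite sqrrN opprK addrC oppr_ge0 => /(_ x0).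
have := @expR_ge1Dxn _ x 1%N x0; have := expR_gt0 (- x).
rewrite (_ : 2`!%:R = 2 :> R)//; lra.
Qed.

Section law.
Context (R : realType) (disp : measure_display) (T : measurableType disp).
Context (P : probability T R).

Lemma integral_cst_probability (c : R) : (\int[P]_w c%:E = c%:E)%E.
Proof.
rewrite integral_cst//= -[RHS]mule1; congr (_ * _)%E; exact: probability_setT.
Qed.

Lemma normal_law_mgf (X : T -> R) (m s : R) :
  measurable_fun [set: T] X ->
  (forall A, measurable A -> P (X @^-1` A) = normal_law m s A) ->
  forall a, (\int[P]_w (expR (a * X w))%:E =
             (expR (a * m + a ^+ 2 * s ^+ 2 / 2))%:E)%E.
Proof.
move=> mX lawX a.
have mf : measurable_fun [set: R] (fun x : R => (expR (a * x))%:E).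
  by apply/measurable_EFinP; apply: measurableT_comp => //; exact: measurable_funM.
have [s0|s0] := eqVneq s 0.
  have -> : (\int[P]_w (expR (a * X w))%:E =
      \int[pushforward P X]_x (expR (a * x))%:E)%E.
    by rewrite ge0_integral_pushforward.
  rewrite (eq_measure_integral (\d_m : set R -> \bar R)) => [|A mA _]; last first.
    transitivity (P (X @^-1` A)) => //.
    by rewrite lawX// /normal_law s0 eqxx.
  by rewrite integral_dirac// diracT mul1e s0 expr0n/= mulr0 mul0r addr0.
have -> : (\int[P]_w (expR (a * X w))%:E =
    \int[pushforward P (X : T -> measurableTypeR R)]_x (expR (a * x))%:E)%E.
  by rewrite ge0_integral_pushforward.
transitivity (\int[normal_prob m s]_x (expR (a * x))%:E)%E.
  apply: eq_measure_integral => A mA _; transitivity (P (X @^-1` A)) => //.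
  by rewrite lawX// /normal_law (negbTE s0).
rewrite ge0_integral_normal_prob//.
under eq_integral do rewrite -EFinM normal_pdf_tilt// EFinM.
rewrite ge0_integralZl//.
- by rewrite integral_normal_pdf mule1.
- by apply/measurable_EFinP; exact: measurable_normal_pdf.
- by move=> x _; rewrite lee_fin normal_pdf_ge0.
Qed.


Lemma normal_law_integrable_expR (X : T -> R) (m s : R) :
  measurable_fun [set: T] X ->
  (forall A, measurable A -> P (X @^-1` A) = normal_law m s A) ->
  forall a, P.-integrable [set: T] (fun w => (expR (a * X w))%:E).
Proof.
move=> mX lawX a; apply/integrableP; split.
  apply/measurable_EFinP; apply: measurableT_comp => //.
  exact: measurable_funM.
under eq_integral do rewrite gee0_abs ?lee_fin ?expR_ge0//.
by rewrite (normal_law_mgf mX lawX) ltry.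
Qed.

Lemma normal_law_integrable_sqr (X : T -> R) (m s : R) :
  measurable_fun [set: T] X ->
  (forall A, measurable A -> P (X @^-1` A) = normal_law m s A) ->
  P.-integrable [set: T] (fun w => (X w ^+ 2)%:E).
Proof.
move=> mX lawX.
have h a := normal_law_integrable_expR mX lawX a.
have := @integrableZl _ _ _ P _ measurableT 2 _
  (integrableD measurableT (h 1) (h (-1))).
apply: le_integrable => //.
  by apply/measurable_EFinP; exact: measurable_funX.
move=> w _ /=; rewrite lee_fin ger0_norm ?sqr_ge0// mul1r mulN1r.
by rewrite (le_trans (sqr_le_expRD _))// ler_norm.
Qed.

Lemma normal_law_integrable (X : T -> R) (m s : R) :
  measurable_fun [set: T] X ->
  (forall A, measurable A -> P (X @^-1` A) = normal_law m s A) ->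
  P.-integrable [set: T] (EFin \o X).
Proof.
move=> mX lawX.
have h a := normal_law_integrable_expR mX lawX a.
have := integrableD measurableT (h 1) (h (-1)).
apply: le_integrable => //; first exact/measurable_EFinP.
move=> w _ /=; rewrite lee_fin mul1r mulN1r.
by rewrite (le_trans (normr_le_expRD _))// ler_norm.
Qed.

(** Integrating [1 + a * X <= expR (a * X)] gives [0 <= a * m + a ^+ 2 * s ^+ 2 / 2] for every [a],
    which forces [m = 0]. *)
Lemma normal_law_mean0 (X : T -> R) (m s : R) :
  measurable_fun [set: T] X ->
  (forall A, measurable A -> P (X @^-1` A) = normal_law m s A) ->
  (\int[P]_w (X w)%:E = 0)%E -> m = 0.
Proof.
move=> mX lawX X0; have iX := normal_law_integrable mX lawX.
have key a : 0 <= a * m + a ^+ 2 * s ^+ 2 / 2.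
  rewrite -ler_expR expR0 -lee_fin -(normal_law_mgf mX lawX).
  have -> : (1%:E = \int[P]_w (1 + a * X w)%:E)%E.
    under eq_integral do rewrite EFinD EFinM.
    rewrite integralD//=; first last.
    - exact: integrableZl.
    - exact: finite_measure_integrable_cst.
    by rewrite integralZl// X0 mule0 adde0 integral_cst_probability.
  apply: le_integral => //.
  - have -> : (fun w => (1 + a * X w)%:E) =
        (cst 1 \+ (fun w => a%:E * (EFin \o X) w))%E by [].
    apply: integrableD => //; first exact: finite_measure_integrable_cst.
    exact: integrableZl.
  - exact: normal_law_integrable_expR mX lawX a.
  - by move=> w _; rewrite lee_fin expR_ge1Dx.
have [s0|s0] := eqVneq s 0.
  have := key 1; have := key (-1); rewrite s0; lra.
have s2 : 0 < s ^+ 2 by rewrite exprn_even_gt0.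
(* The minimizer of the quadratic in [a]. *)
have := key (- m / s ^+ 2).
rewrite (_ : _ + _ = - (m ^+ 2 / s ^+ 2) / 2); last by field.
move=> h; have : m ^+ 2 / s ^+ 2 <= 0 by lra.
by rewrite pmulr_lle0 ?invr_gt0// exprn_even_le0//= => /eqP.
Qed.

(** The second moment is the limit of the symmetric second difference quotients of the moment
    generating function at 0. Halving the step makes the quotients [f n] decrease pointwise, so
    [f 0] dominates them all. *)
Lemma normal_law_variance (X : T -> R) (s : R) :
  measurable_fun [set: T] X ->
  (forall A, measurable A -> P (X @^-1` A) = normal_law 0 s A) ->
  (\int[P]_w (X w ^+ 2)%:E = (s ^+ 2)%:E)%E.
Proof.
move=> mX lawX.
have iexp a := normal_law_integrable_expR mX lawX a.
pose b n : R := 2^-1 ^+ n.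
have b0 n : 0 < b n by rewrite exprn_gt0.
have bcvg : b @ \oo --> (0 : R).
  by apply: cvg_expr; rewrite ger0_norm// invf_lt1// ltr1n.
pose f n w : R := (expR (b n * X w) + expR (- b n * X w) - 2) / b n ^+ 2.
have f_ge0 n w : 0 <= f n w.
  rewrite /f mulr_ge0 ?invr_ge0 ?sqr_ge0// mulNr.
  have e1 : expR (b n * X w) * expR (- (b n * X w)) = 1 by rewrite expRxMexpNx_1.
  have := expR_gt0 (b n * X w); have := expR_gt0 (- (b n * X w)).
  have := sqr_ge0 (expR (b n * X w) - expR (- (b n * X w))); nra.
(* Over the common denominator, the two numerators differ by the square of
   [expR c + expR (- c) - 2]. *)
have f_S n w : f n.+1 w <= f n w.
  have bE : b n = b n.+1 * 2 by rewrite /b exprS; field.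
  rewrite /f bE.
  set c := b n.+1 * X w.
  rewrite mulNr (_ : b n.+1 * 2 * X w = c + c); last by rewrite /c; ring.
  rewrite (_ : - (b n.+1 * 2) * X w = - c + - c); last by rewrite /c; ring.
  rewrite !expRD exprMn.
  rewrite (_ : b n.+1 * X w = c)//.
  have e1 : expR c * expR (- c) = 1 by rewrite expRxMexpNx_1.
  have -> : (expR c + expR (- c) - 2) / b n.+1 ^+ 2 =
      (expR c + expR (- c) - 2) * 4 / (b n.+1 ^+ 2 * 2 ^+ 2).
    by field; rewrite gt_eqF.
  rewrite ler_pM2r ?invr_gt0 ?mulr_gt0 ?exprn_gt0//.
  have := sqr_ge0 (expR c + expR (- c) - 2); nra.
have f_le0 n w : f n w <= f 0%N w.
  by elim: n => // n; exact: le_trans.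
have f_cvg w : (fun n => f n w) @ \oo --> X w ^+ 2.
  have -> : (fun n => f n w) =
      (fun n => expR (- (X w * b n)) * ((expR (X w * b n) - 1) / b n) ^+ 2).
    apply/funext => n; rewrite /f exprMn exprVn mulrA; congr (_ / _).
    rewrite mulNr [b n * _]mulrC.
    have e1 : expR (X w * b n) * expR (- (X w * b n)) = 1.
      by rewrite expRxMexpNx_1.
    by ring: e1.
  rewrite -[X in _ --> X]mul1r; apply: cvgM; last first.
    rewrite expr2; under eq_fun do rewrite expr2.
    by apply: cvgM; exact: cvg_expR_slope.
  rewrite -(expR0 R); apply: (@continuous_cvg _ _ _ _ _ _ (@expR R)) => //.
    exact: continuous_expR.
  rewrite -oppr0 -(mulr0 (X w)); apply: cvgN; apply: cvgM => //; exact: cvg_cst.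
have mf n : measurable_fun [set: T] (f n).
  apply: measurable_funM => //; apply: measurable_funB => //.
  by apply: measurable_funD; apply: measurableT_comp => //; exact: measurable_funM.
have fE n : (fun w => (f n w)%:E) =
    (fun w => ((b n ^+ 2)^-1)%:E * ((expR (b n * X w))%:E +
       (expR (- b n * X w))%:E + (- 2)%:E))%E.
  by apply/funext => w; rewrite /f mulrC.
have if_ n : P.-integrable [set: T] (fun w => (f n w)%:E).
  rewrite fE; apply: integrableZl => //; apply: integrableD => //.
    exact: integrableD.
  exact: finite_measure_integrable_cst.
have Ef n : (\int[P]_w (f n w)%:E =
    ((expR (s ^+ 2 / 2 * b n ^+ 2) - 1) / b n ^+ 2 * 2)%:E)%E.
  rewrite fE integralZl//; last first.
    apply: integrableD => //; first exact: integrableD.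
    exact: finite_measure_integrable_cst.
  rewrite integralD//; last 2 first.
    exact: integrableD.
    exact: finite_measure_integrable_cst.
  rewrite integralD// !(normal_law_mgf mX lawX) integral_cst_probability.
  rewrite -!EFinD -EFinM; congr EFin.
  rewrite !mulr0 !add0r sqrrN (_ : b n ^+ 2 * s ^+ 2 / 2 = s ^+ 2 / 2 * b n ^+ 2); last by ring.
  by ring.
have lim1 : (fun n => \int[P]_w (f n w)%:E)%E @ \oo --> (s ^+ 2)%:E.
  under eq_fun do rewrite Ef.
  apply: cvg_EFin; first exact: nearW.
  have s2 : s ^+ 2 = s ^+ 2 / 2 * 2 by field.
  rewrite [X in _ --> X]s2.
  apply: cvgM; last exact: cvg_cst.
  apply: (@cvg_expR_slope _ _ (fun n => b n ^+ 2)) => [n|]; first by rewrite exprn_gt0.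
  rewrite -[X in _ --> X](mulr0 0); under eq_fun do rewrite expr2.
  exact: cvgM.
have lim2 : (fun n => \int[P]_w (f n w)%:E)%E @ \oo -->
    (\int[P]_w (X w ^+ 2)%:E)%E.
  apply: (@dominated_cvg _ _ _ P _ measurableT (fun n w => (f n w)%:E) _
    (fun w => (f 0%N w)%:E)) => //.
  - by move=> n; exact/measurable_EFinP.
  - by move=> w _; apply: cvg_EFin; [exact: nearW|exact: f_cvg].
  - by move=> n w _; rewrite lee_fin ger0_norm.
exact: (cvg_unique _ lim2 lim1).
Qed.

(** The law of a linear combination is known to be normal, but with unspecified parameters; they are
    recovered from its first two moments, which bilinearity expresses through those of the
    coordinates. The coordinates are themselves normal, being combinations with unit weights, and
    this provides the integrability. *)
Lemma gaussian_vector_mgf (d : nat) (C : 'M[R]_d) (X : 'I_d -> T -> R) :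
  (forall i, measurable_fun [set: T] (X i)) -> gaussian_vector P 0 C X ->
  forall th : 'I_d -> R,
  (\int[P]_w (expR (\sum_i th i * X i w))%:E =
   (expR ((\sum_i \sum_j th i * th j * C i j) / 2))%:E)%E.
Proof.
move=> mX [lawX EX covX] th.
have mlin (a : 'I_d -> R) : measurable_fun [set: T] (fun w => \sum_i a i * X i w).
  by apply: measurable_sum => i; exact: measurable_funM.
have law1 i : exists mu s : R, forall A : set R, measurable A ->
    P (X i @^-1` A) = normal_law mu s A.
  have [mu [s [_ h]]] := lawX (fun j => (j == i)%:R).
  exists mu, s; suff -> : X i = (fun w => \sum_j (j == i)%:R * X j w) by [].
  apply/funext => w; rewrite (bigD1 i)//= eqxx mul1r big1 ?addr0// => j /negbTE ->.
  by rewrite mul0r.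
have iX i : P.-integrable [set: T] (EFin \o X i).
  by have [mu [s h]] := law1 i; exact: normal_law_integrable h.
have iX2 i : P.-integrable [set: T] (fun w => (X i w ^+ 2)%:E).
  by have [mu [s h]] := law1 i; exact: normal_law_integrable_sqr h.
have iXX i j : P.-integrable [set: T] (fun w => (X i w * X j w)%:E).
  have := integrableD measurableT (iX2 i) (iX2 j).
  apply: le_integrable => //.
    by apply/measurable_EFinP; exact: measurable_funM.
  move=> w _ /=; rewrite lee_fin [leRHS]ger0_norm ?addr_ge0 ?sqr_ge0//.
  rewrite ler_norml; have := sqr_ge0 (X i w + X j w).
  have := sqr_ge0 (X i w - X j w); have := sqr_ge0 (X i w).
  have := sqr_ge0 (X j w); move=> *; apply/andP; split; nra.
have EX0 i : (\int[P]_w (X i w)%:E = 0)%E.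
  by have := EX i; rewrite unlock mxE.
have EXX i j : (\int[P]_w (X i w * X j w)%:E = (C i j)%:E)%E.
  rewrite -covX unlock/= unlock; apply: eq_integral => w _.
  have e k : fine (\int[P]_x (X k x)%:E)%E = 0 by rewrite EX0.
  rewrite !e; congr EFin.
  by change (X i w * X j w = (X i w - 0) * (X j w - 0)); rewrite !subr0.
have [mu [s [s0 lawth]]] := lawX th.
have mu0 : mu = 0.
  apply: (normal_law_mean0 (mlin th) lawth).
  under eq_integral do rewrite -sumEFin.
  rewrite integral_sum// => [|i]; last first.
    exact: (integrableZl measurableT (th i) (iX i)).
  rewrite big1// => i _; under eq_integral do rewrite EFinM.
  by rewrite (integralZl measurableT (iX i)) EX0 mule0.
rewrite {mu}mu0 in lawth.
have s2E : s ^+ 2 = \sum_i \sum_j th i * th j * C i j.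
  apply: EFin_inj; rewrite -(normal_law_variance (mlin th) lawth).
  have -> : (fun w => ((\sum_i th i * X i w) ^+ 2)%:E) =
      (fun w => \sum_i \sum_j (th i * th j)%:E * (X i w * X j w)%:E)%E.
    apply/funext => w; rewrite expr2 big_distrl/= -sumEFin; apply: eq_bigr => i _.
    rewrite big_distrr/= -sumEFin; apply: eq_bigr => j _.
    by rewrite -EFinM; congr EFin; ring.
  rewrite integral_sum// => [|i]; last first.
    by apply: integrable_sum => // j _; exact: integrableZl.
  rewrite -sumEFin; apply: eq_bigr => i _.
  rewrite integral_sum// => [|j]; last exact: integrableZl.
  rewrite -sumEFin; apply: eq_bigr => j _.
  by rewrite (integralZl measurableT (iXX i j)) EXX.
have := normal_law_mgf (mlin th) lawth 1.
under eq_integral do rewrite mul1r.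
by move=> ->; rewrite mulr0 add0r expr1n mul1r s2E.
Qed.

End law.

(** * Independence from the past *)

Section independence.
Context (R : realType) (disp : measure_display) (T : measurableType disp).
Context (P : probability T R).

(** The joint law is the product of the marginals, as both agree on rectangles; Tonelli then factors
    the integral. *)
Lemma ge0_integral_indep (dE dU : measure_display) (E : measurableType dE)
    (U : measurableType dU) (W : T -> E) (Z : T -> U)
    (f : E -> \bar R) (g : U -> \bar R) :
  measurable_fun [set: T] W -> measurable_fun [set: T] Z ->
  (forall A B, measurable A -> measurable B ->
    P (W @^-1` A `&` Z @^-1` B) = (P (W @^-1` A) * P (Z @^-1` B))%E) ->
  measurable_fun [set: E] f -> measurable_fun [set: U] g ->
  (forall x, 0 <= f x)%E -> (forall y, 0 <= g y)%E ->
  (\int[P]_w (f (W w) * g (Z w)) = \int[P]_w f (W w) * \int[P]_w g (Z w))%E.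
Proof.
move=> mW mZ indep mf mg f0 g0.
have mWZ : measurable_fun [set: T] (fun w => (W w, Z w)).
  exact: measurable_fun_pair.
pose W' : {mfun T >-> E} := HB.pack W (isMeasurableFun.Build _ _ _ _ _ mW).
pose Z' : {mfun T >-> U} := HB.pack Z (isMeasurableFun.Build _ _ _ _ _ mZ).
pose V' : {mfun T >-> (E * U)%type} :=
  HB.pack (fun w => (W w, Z w)) (isMeasurableFun.Build _ _ _ _ _ mWZ).
pose F (z : E * U) := (f z.1 * g z.2)%E.
have mF : measurable_fun [set: E * U] F.
  by apply: emeasurable_funM; exact: measurableT_comp.
have F0 z : (0 <= F z)%E by exact: mule_ge0.
transitivity (\int[distribution P V']_z F z)%E.
  by rewrite ge0_integral_distribution.
transitivity (\int[(distribution P W' \x distribution P Z')%E]_z F z)%E.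
  apply: eq_measure_integral => A mA _; apply/esym.
  exact: product_measure_unique.
rewrite fubini_tonelli1// /fubini_F.
transitivity (\int[distribution P W']_x (f x * \int[P]_w g (Z w)))%E.
  apply: eq_integral => x _.
  transitivity (\int[distribution P Z']_y (f x * g y))%E => //.
  rewrite ge0_integralZl//.
  by rewrite ge0_integral_distribution.
rewrite ge0_integralZr//; last by apply: integral_ge0.
by rewrite ge0_integral_distribution.
Qed.

(** Both sides are finite measures in [A] that agree on the pi-system [G], which contains the whole
    space. *)
Lemma pi_lambda_indep (G : set (set T)) (D : set T) :
  G `<=` measurable -> setI_closed G -> G [set: T] -> measurable D ->
  (forall A, G A -> P (A `&` D) = (P A * P D)%E) ->
  forall A, <<s G >> A -> P (A `&` D) = (P A * P D)%E.
Proof.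
move=> mG GI GT mD GD A sA.
have p0 : 0 <= fine (P D) by rewrite fine_ge0.
pose c : {nonneg R} := NngNum p0.
have PDE : (fine (P D))%:E = P D by rewrite fineK// fin_num_measure.
have cE X : mscale c P X = (P X * P D)%E.
  by rewrite muleC -[in RHS]PDE.
transitivity (mscale c P A) => //.
apply: (@g_sigma_algebra_measure_unique _ _ T G mG (fun=> setT) (fun=> GT)
  _ (mrestr P mD) (mscale c P) GI) => //.
- by apply/seteqP; split => // x _; exists 0%N.
- by move=> A0 GA0; transitivity (P A0 * P D)%E; [rewrite -GD|rewrite -cE].
- by move=> _; rewrite -ge0_fin_numE// fin_num_measure//; exact: measurableI.
Qed.

Section past.
Context (dU : measure_display) (U : measurableType dU) (xi : nat -> T -> U).
Hypothesis mxi : forall l, measurable_fun [set: T] (xi l).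

(** A pi-system generating the sigma-algebra of [xi 0, .., xi (k - 1)], which plays the role of the
    past at step [k]. *)
Definition past_rect (k : nat) : set (set T) :=
  [set C | exists2 A : nat -> set U, forall l, measurable (A l) &
    C = [set w | forall l, (l < k)%N -> A l (xi l w)]].

Lemma past_rect_measurable k : past_rect k `<=` measurable.
Proof.
move=> _ [A mA ->].
rewrite [X in measurable X](_ : _ = \bigcap_(l in `I_k) (xi l @^-1` A l))//.
apply: bigcap_measurableType => l _; rewrite -[X in measurable X]setTI.
exact: mxi.
Qed.

Lemma past_rectT k : past_rect k [set: T].
Proof. by exists (fun=> setT) => //; apply/seteqP; split. Qed.

Lemma past_rectI k : setI_closed (past_rect k).
Proof.
move=> _ _ [A mA ->] [B mB ->]; exists (fun l => A l `&` B l).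
  by move=> l; exact: measurableI.
apply/seteqP; split => w /=; first by move=> [a b] l lk; split; [exact: a|exact: b].
by move=> h; split => l /h[].
Qed.

Lemma past_rect_sub k A : <<s past_rect k >> A -> measurable A.
Proof.
apply: smallest_sub; first exact: sigma_algebra_measurable.
exact: past_rect_measurable.
Qed.

Lemma past_measurable_xi k l : (l < k)%N ->
  measurable_fun [set: g_sigma_algebraType (past_rect k)]
    (xi l : g_sigma_algebraType (past_rect k) -> U).
Proof.
move=> lk _ Y mY; rewrite setTI; apply: sub_sigma_algebra.
exists (fun j => if j == l then Y else setT); first by move=> j; case: ifP.
apply/seteqP; split => w /=; first by move=> Yw j jk; case: eqVneq => // ->.
by move=> /(_ _ lk); rewrite eqxx.
Qed.

(** For a rectangle of the past, independence of [k + 1] terms splits the intersection into a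
    product, and independence of the first [k] terms folds all but the last factor back into
    [P A]. *)
Lemma past_rect_indep k :
  mutually_independent P (fun (l : 'I_k) => xi l) ->
  mutually_independent P (fun (l : 'I_k.+1) => xi l) ->
  forall A B, <<s past_rect k >> A -> measurable B ->
  P (A `&` xi k @^-1` B) = (P A * P (xi k @^-1` B))%E.
Proof.
move=> ik ik1 A B sA mB.
have mxB : measurable (xi k @^-1` B) by rewrite -[X in measurable X]setTI; exact: mxi.
apply: (pi_lambda_indep (@past_rect_measurable k) (@past_rectI k) (past_rectT k)) => //.
move=> _ [C mC ->].
have := ik (fun l => C l) (fun l => mC l).
rewrite [X in P X = _ -> _](_ : _ = [set w | forall l, (l < k)%N -> C l (xi l w)]).
  move=> ->.
  have mC' (l : 'I_k.+1) : measurable (if (l < k)%N then C l else B) by case: ifP.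
  have := ik1 _ mC'.
  rewrite big_ord_recr/= ltnn => h; rewrite -[RHS]/(_ * _)%E.
  rewrite (eq_bigr (fun l : 'I_k => P (xi l @^-1` C l))) in h; last first.
    by move=> l _; rewrite ltn_ord.
  rewrite -h; congr (P _); apply/seteqP; split => w /=.
    move=> [Cw Bw] l _ /=; case: ifPn => [lk|]; first exact: Cw.
    rewrite -leqNgt => kl; suff -> : nat_of_ord l = k by [].
    by apply/eqP; rewrite eqn_leq kl -ltnS ltn_ord.
  move=> h'; split; last by have := h' ord_max I; rewrite /= ltnn.
  move=> l lk; have := h' (Ordinal (ltnW lk : (l < k.+1)%N)) I.
  by rewrite /= lk.
apply/seteqP; split => w /= h; first by move=> l lk; exact: (h (Ordinal lk)).
by move=> l _; exact: h.
Qed.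

End past.
End independence.

(** * Passage times of continuous paths *)

Section paths.
Context (R : realType).
Implicit Types (s x : R -> R) (c u : R).

Definition path_continuous s := {within `[0, +oo[, continuous s}.

Lemma path_continuous_cvg s (t : nat -> R) (l : R) : path_continuous s ->
  (forall n, 0 <= t n) -> 0 <= l -> t @ \oo --> l ->
  (fun n => s (t n)) @ \oo --> s l.
Proof.
move=> cs t0 l0 tl.
have /continuous_within_itvcyP[cin c0] := cs.
have [l_gt0|l_eq0] : 0 < l \/ l = 0.
  by move: l0; rewrite le_eqVlt => /orP[/eqP|]; [right|left].
  apply: (@continuous_cvg _ _ _ _ _ _ s) => //.
  by apply: cin; rewrite in_itv/= andbT.
rewrite {l l0}l_eq0 in tl *.
apply/cvgrPdist_lt => e e0.
have /cvgrPdist_lt/(_ e e0) := c0.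
rewrite near_withinE => /nbhs_ballP[d /= d0 hd].
have /cvgrPdist_lt/(_ d d0) := tl.
apply: filterS => n nd.
have := t0 n; rewrite le_eqVlt => /orP[/eqP <-|tn0]; first by rewrite subrr normr0.
exact: hd.
Qed.

Definition grid (N k : nat) : R := k%:R / 2 ^+ N.

Lemma grid_ge0 N k : 0 <= grid N k.
Proof. by rewrite /grid divr_ge0// exprn_ge0. Qed.

Lemma grid_refine N M k : (N <= M)%N -> grid N k = grid M (k * 2 ^ (M - N)).
Proof.
move=> NM; rewrite /grid -{2}(subnKC NM) natrM natrX exprD invfM mulrACA.
by rewrite divff ?mulr1// expf_neq0.
Qed.

Lemma grid_le N k k' : (grid N k <= grid N k') = (k <= k')%N.
Proof. by rewrite /grid ler_pM2r ?invr_gt0 ?exprn_gt0// ler_nat. Qed.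

Lemma cvg_mesh : (fun N => (2 ^+ N)^-1 : R) @ \oo --> (0 : R).
Proof.
rewrite (_ : (fun N => (2 ^+ N)^-1 : R) = (fun N => 2^-1 ^+ N)); last first.
  by apply/funext => N; rewrite exprVn.
by apply: cvg_expr; rewrite ger0_norm// invf_lt1// ltr1n.
Qed.

Definition grid_ceil (N : nat) (t : R) : nat := (Num.truncn (t * 2 ^+ N)).+1.

Lemma grid_ceil_gt N t : 0 <= t -> t < grid N (grid_ceil N t).
Proof.
move=> t0; rewrite /grid ltr_pdivlMr ?exprn_gt0//.
exact: truncnS_gt.
Qed.

Lemma grid_ceil_le N t : 0 <= t -> grid N (grid_ceil N t) <= t + (2 ^+ N)^-1.
Proof.
move=> t0; rewrite /grid ler_pdivrMr ?exprn_gt0// mulrDl mulVf ?expf_neq0//.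
by rewrite /grid_ceil -(natr1 (Num.truncn _)) lerD2r truncn_le// mulr_ge0// exprn_ge0.
Qed.

Lemma grid_ceil_cvg t : 0 <= t ->
  (fun N => grid N (grid_ceil N t)) @ \oo --> t.
Proof.
move=> t0; apply: (@squeeze_cvgr _ _ _ _ (cst t) (fun N => t + (2 ^+ N)^-1)).
- by apply: nearW => N; rewrite ltW ?grid_ceil_gt// grid_ceil_le.
- exact: cvg_cst.
- rewrite -[X in _ --> X]addr0; apply: cvgD; first exact: cvg_cst.
  exact: cvg_mesh.
Qed.

Definition first_passage (a : nat -> R) c (k : nat) : bool :=
  (c <= a k) && [forall j : 'I_k, a j < c].

Lemma first_passageP (a : nat -> R) c k : c <= a k ->
  exists2 j, (j <= k)%N & first_passage a c j.
Proof.
move=> ck; have ex : exists j, c <= a j by exists k.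
exists (ex_minn ex); first by case: ex_minnP => m _; exact.
case: ex_minnP => m cm min; rewrite /first_passage cm; apply/forallP => j.
by rewrite ltNge; apply/negP => /min; rewrite leqNgt ltn_ord.
Qed.

Lemma first_passage_uniq (a : nat -> R) c j k :
  first_passage a c j -> first_passage a c k -> j = k.
Proof.
move=> /andP[cj /forallP hj] /andP[ck /forallP hk].
case: (ltngtP j k) => // jk.
  by have := hk (Ordinal jk); rewrite ltNge cj.
by have := hj (Ordinal jk); rewrite ltNge ck.
Qed.

Lemma sum_first_passage (a x : nat -> R) c n k :
  (k < n)%N -> first_passage a c k ->
  \sum_(j < n) x j * (first_passage a c j)%:R = x k.
Proof.
move=> kn fk; rewrite (bigD1 (Ordinal kn))//= fk mulr1 big1 ?addr0// => j jk.
case: (boolP (first_passage a c j)) => [fj|]; last by rewrite mulr0.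
by move/eqP: jk; case; apply: val_inj; exact: first_passage_uniq fj fk.
Qed.

(** Hits on all grids together. The grids are nested, so first passages along finer and finer grids
    decrease to the infimum. This infimum can exceed the true passage time, when the path touches
    [c] between dyadic points without crossing it. *)
Definition dyadic_hits s c : set R :=
  [set t | exists N k, t = grid N k /\ c <= s t].

Definition dyadic_time s c : R := inf (dyadic_hits s c).

Lemma dyadic_hits_lb s c : has_lbound (dyadic_hits s c).
Proof. by exists 0 => _ [N [k [-> _]]]; exact: grid_ge0. Qed.

Lemma dyadic_time_ge0 s c : dyadic_hits s c !=set0 -> 0 <= dyadic_time s c.
Proof.
move=> h0; apply: lb_le_inf => // _ [N [k [-> _]]]; exact: grid_ge0.
Qed.

(* The value of [x] at the first passage of [s] above [c] along the grid of
   mesh 2 ^- N, among times at most N (and 0 if there is none). *)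
Definition grid_stop s x c (N : nat) : R :=
  \sum_(k < (N * 2 ^ N).+1)
     x (grid N k) * (first_passage (fun j => s (grid N j)) c k)%:R.

Lemma grid_first_passage_cvg s c : dyadic_hits s c !=set0 ->
  exists k : nat -> nat, exists N0,
    [/\ forall N, (N0 <= N)%N ->
          first_passage (fun j => s (grid N j)) c (k N) /\ (k N <= N * 2 ^ N)%N,
        (fun N => grid N (k N)) @ \oo --> dyadic_time s c &
        forall N, 0 <= grid N (k N)].
Proof.
move=> h0; have [t0 [N0 [k0 [t0E ct0]]]] := h0.
have ex N : exists k, (N0 <= N)%N -> first_passage (fun j => s (grid N j)) c k.
  have [NN|] := leqP N0 N; last by exists 0%N.
  have : c <= s (grid N (k0 * 2 ^ (N - N0))) by rewrite -grid_refine// -t0E.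
  by move=> /(first_passageP (a := fun j => s (grid N j)))[j _ fj]; exists j.
have [k kP] := choice ex.
(* A hit on a coarse grid is also a point of every finer grid, so the first passage there comes no
   later. *)
have kub N M q : (N0 <= M)%N -> (N <= M)%N -> c <= s (grid N q) ->
    grid M (k M) <= grid N q.
  move=> N0M NM cq; rewrite (grid_refine _ NM) grid_le leqNgt; apply/negP => lt.
  have /andP[_ /forallP/(_ (Ordinal lt))] := kP _ N0M.
  by rewrite /= -grid_refine// ltNge cq.
(* From [N0] on the grid contains the hit [t0]; from the integer [grid_ceil 0 t0] on the horizon [N]
   exceeds [t0]. *)
exists k, (maxn N0 (grid_ceil 0 t0)); split.
- move=> N; rewrite geq_max => /andP[N0N tN]; split; first exact: kP.
  rewrite -(grid_le N); apply: (le_trans (kub N0 N k0 _ _ _)) => //.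
    by rewrite -t0E.
  rewrite -t0E; have t00 : 0 <= t0 by rewrite t0E grid_ge0.
  apply: (le_trans (ltW (grid_ceil_gt 0 t00))).
  rewrite /grid natrM natrX mulfK ?expf_neq0// expr0 divr1 ler_nat//.
- apply/cvgrPdist_lt => e e0.
  have [_ [M [q [-> cq]]] hq] := inf_adherent e0 (conj h0 (dyadic_hits_lb s c)).
  exists (maxn N0 M) => // N /=; rewrite geq_max => /andP[N0N MN].
  have h1 : dyadic_time s c <= grid N (k N).
    apply: ge_inf; first exact: dyadic_hits_lb.
    by exists N, (k N); split => //; have /andP[] := kP _ N0N.
  have h2 := kub _ _ _ N0N MN cq.
  rewrite distrC ger0_norm ?subr_ge0//.
  by rewrite ltrBlDl (le_lt_trans h2)// -/(dyadic_time s c).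
- by move=> N; exact: grid_ge0.
Qed.

Lemma grid_stop_cvg s x c : path_continuous x -> dyadic_hits s c !=set0 ->
  grid_stop s x c @ \oo --> x (dyadic_time s c).
Proof.
move=> cx h0; have [k [N0 [kP kcvg k0]]] := grid_first_passage_cvg h0.
have xk := path_continuous_cvg cx k0 (dyadic_time_ge0 h0) kcvg.
apply: (cvg_trans _ xk); apply: near_eq_cvg; exists N0 => // N /= NN.
have [fk kN] := kP _ NN.
by rewrite /grid_stop (sum_first_passage (fun j => x (grid N j)) _ fk).
Qed.

Lemma dyadic_time_hits s c : path_continuous s -> dyadic_hits s c !=set0 ->
  c <= s (dyadic_time s c).
Proof.
move=> cs h0; have [k [N0 [kP kcvg k0]]] := grid_first_passage_cvg h0.
have sk := path_continuous_cvg cs k0 (dyadic_time_ge0 h0) kcvg.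
apply: (cvgr_to_ge sk); exists N0 => // N /= /kP[/andP[h _] _]; exact: h.
Qed.

Definition passage_set s u : set R := [set t | 0 <= t /\ u <= s t].

Definition passage_time s u : R := inf (passage_set s u).

(** Levels strictly below [u]: by continuity, a path that merely touches [u] exceeds each of them on
    a whole neighbourhood, hence at dyadic times. *)
Definition lower_level u (m : nat) : R := u - m.+1%:R^-1.

Lemma lower_level_lt u m : lower_level u m < u.
Proof. by rewrite /lower_level ltrBlDl ltrDr invr_gt0. Qed.

Lemma lower_level_cvg u : lower_level u @ \oo --> u.
Proof.
rewrite -[X in _ --> X]subr0; apply: cvgB; first exact: cvg_cst.
exact: cvg_harmonic.
Qed.

Lemma dyadic_hit_near s u c t e : path_continuous s -> 0 <= t -> u <= s t ->
  c < u -> 0 < e -> exists2 q, dyadic_hits s c q & q <= t + e.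
Proof.
move=> cs t0 ut cu e0.
have sg := path_continuous_cvg cs (fun N => grid_ge0 N (grid_ceil N t)) t0
  (grid_ceil_cvg t0).
have st : c < s t by exact: lt_le_trans cu ut.
have near1 : \forall N \near \oo, c < s (grid N (grid_ceil N t)).
  exact: (cvgr_gt _ sg).
have near2 : \forall N \near \oo, grid N (grid_ceil N t) < t + e.
  by apply: (cvgr_lt _ (grid_ceil_cvg t0)); rewrite ltrDl.
have [N [h1 h2]]   := filter_ex (filterI near1 near2).
exists (grid N (grid_ceil N t)); last exact: ltW.
by exists N, (grid_ceil N t); split => //; exact: ltW.
Qed.

Lemma passage_set_lb s u : has_lbound (passage_set s u).
Proof. by exists 0 => t []. Qed.

Lemma dyadic_time_le_passage s u c : path_continuous s -> passage_set s u !=set0 ->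
  c < u -> dyadic_time s c <= passage_time s u.
Proof.
move=> cs h0 cu; apply: lb_le_inf => // t [t0 ut].
apply/ler_addgt0Pr => e e0.
have [q hq qe] := dyadic_hit_near cs t0 ut cu e0.
by apply: le_trans qe; apply: ge_inf => //; exact: dyadic_hits_lb.
Qed.

Lemma passage_dyadic_hits s u c : path_continuous s -> passage_set s u !=set0 ->
  c < u -> dyadic_hits s c !=set0.
Proof.
move=> cs [t [t0 ut]] cu.
by have [q hq _] := dyadic_hit_near cs t0 ut cu ltr01; exists q.
Qed.

(** The dyadic times increase with the level, so boundedness makes them converge, and continuity
    carries the levels to [u] in the limit. Dyadic information alone thus produces a genuine
    passage; both [dyadic_time_cvg] and the measurability of ruin rest on this. *)
Lemma bounded_dyadic_times_passage s u (b : R) : path_continuous s ->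
  (forall m, dyadic_hits s (lower_level u m) !=set0) ->
  (forall m, dyadic_time s (lower_level u m) <= b) ->
  exists l, [/\ (fun m => dyadic_time s (lower_level u m)) @ \oo --> l,
    0 <= l, l <= b & u <= s l].
Proof.
move=> cs h0 hb; set rho := fun m => dyadic_time s (lower_level u m).
have nd : nondecreasing_seq rho.
  move=> m n mn; apply: lb_le_inf; first exact: h0.
  move=> _ [N [k [-> h]]]; apply: ge_inf; first exact: dyadic_hits_lb.
  exists N, k; split => //; apply: le_trans h.
  by rewrite lerD2l lerN2 lef_pV2 ?posrE// ler_nat ltnS.
have cv : cvgn rho.
  by apply: nondecreasing_is_cvgn => //; exists b => _ [m _ <-]; exact: hb.
exists (limn rho).
have r0 m : 0 <= rho m by exact: dyadic_time_ge0.
have l0 : 0 <= limn rho by apply: limr_ge => //; exact: nearW.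
split => //; first by apply: limr_le => //; exact: nearW.
have slim := path_continuous_cvg cs r0 l0 cv.
have lcvg := @lower_level_cvg u.
apply: (ler_cvg_to lcvg slim); apply: nearW => m; exact: dyadic_time_hits.
Qed.

Lemma dyadic_time_cvg s u : path_continuous s -> passage_set s u !=set0 ->
  [/\ (fun m => dyadic_time s (lower_level u m)) @ \oo --> passage_time s u,
      0 <= passage_time s u & u <= s (passage_time s u)].
Proof.
move=> cs h0.
have [] := @bounded_dyadic_times_passage s u (passage_time s u) cs.
- by move=> m; apply: passage_dyadic_hits h0 _ => //; exact: lower_level_lt.
- by move=> m; apply: dyadic_time_le_passage => //; exact: lower_level_lt.
- move=> l [lcvg l0 lp ul].
  suff -> : passage_time s u = l by [].
  apply/eqP; rewrite eq_le lp andbT; apply: ge_inf; first exact: passage_set_lb.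
  by split.
Qed.

Lemma passage_value s u : path_continuous s -> s 0 < u -> passage_set s u !=set0 ->
  s (passage_time s u) = u.
Proof.
move=> cs s0u h0; have [_ t0 ut] := dyadic_time_cvg cs h0.
apply/eqP; rewrite eq_le ut andbT.
have tgt0 : 0 < passage_time s u.
  rewrite lt_neqAle t0 andbT; apply/eqP => e.
  by move: ut; rewrite -e leNgt s0u.
set t := passage_time s u in ut tgt0 *.
(* Times in [[0, t)] tending to [t]; the path is below [u] at each of them, since [t] is the infimum
   of the passages. *)
pose a (n : nat) : R := t - t / n.+1%:R.
have a_lt n : a n < t by rewrite /a ltrBlDl ltrDr divr_gt0.
have a_ge0 n : 0 <= a n.
  by rewrite /a subr_ge0 ler_pdivrMr// ler_peMr// ?ler1n// ltW.
have acvg : a @ \oo --> t.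
  rewrite -[X in _ --> X]subr0 -[X in _ - X](mulr0 t).
  by apply: cvgB; [exact: cvg_cst|apply: cvgM; [exact: cvg_cst|exact: cvg_harmonic]].
have sa := path_continuous_cvg cs a_ge0 t0 acvg.
apply: (cvgr_to_le sa); apply: nearW => n; rewrite leNgt; apply/negP => /ltW ua.
have : t <= a n by apply: ge_inf; [exact: passage_set_lb|split].
by rewrite leNgt a_lt.
Qed.

(* Otherwise the first passages along finer and finer grids would converge to a
   jump of the path. *)
Lemma no_grid_overshoot s u e n : path_continuous s -> s 0 < u -> 0 < e ->
  \forall N \near \oo, forall k, (k <= n * 2 ^ N)%N ->
    first_passage (fun j => s (grid N j)) u k -> s (grid N k) <= u + e.
Proof.
move=> cs s0u e0.
have [h0|noh] := pselect (dyadic_hits s u !=set0); last first.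
  apply: nearW => N k _ /andP[uk _]; exfalso; apply: noh.
  by exists (grid N k), N, k.
have [k [N0 [kP kcvg k0]]] := grid_first_passage_cvg h0.
have t0 := dyadic_time_ge0 h0.
have sk := path_continuous_cvg cs k0 t0 kcvg.
(* The grid points just before the first passages have the same limit, and the path is below [u]
   there; so the path is at most [u] at the limit. The index [k N] is nonzero because [s 0 < u]. *)
have pcvg : (fun N => grid N (k N).-1) @ \oo --> dyadic_time s u.
  apply: (@squeeze_cvgr _ _ _ _ (fun N => grid N (k N) - (2 ^+ N)^-1)
    (fun N => grid N (k N))) => //.
  - apply: nearW => N; rewrite grid_le leq_pred andbT /grid.
    case: (k N) => [|j]/=; first by rewrite mul0r sub0r oppr_le0 invr_ge0 exprn_ge0.
    by rewrite -(natr1 j) mulrDl mul1r addrK.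
  - rewrite -[X in _ --> X]subr0; apply: cvgB => //; exact: cvg_mesh.
have sp := path_continuous_cvg cs (fun N => grid_ge0 N _) t0 pcvg.
have su : s (dyadic_time s u) <= u.
  apply: (cvgr_to_le sp); exists N0 => // N /= /kP[/andP[uk /forallP hk] _].
  have kN0 : (0 < k N)%N.
    rewrite lt0n; apply/eqP => kE; move: uk; rewrite kE /grid mul0r.
    by rewrite leNgt s0u.
  have lt : ((k N).-1 < k N)%N by rewrite ltn_predL.
  by have := hk (Ordinal lt) => /ltW.
have near1 : \forall N \near \oo, s (grid N (k N)) < u + e.
  by apply: (cvgr_lt _ sk); rewrite (le_lt_trans su)// ltrDl.
have near2 : \forall N \near \oo, (N0 <= N)%N by exists N0.
apply: filterS (filterI near1 near2) => N [h1 /kP[fk _]] j _ fj.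
by rewrite (first_passage_uniq fj fk) ltW.
Qed.

End paths.

(** * Stopped processes *)

Section processes.
Context (R : realType) (disp : measure_display) (T : measurableType disp).

Lemma measurable_bool_natr (b : T -> bool) : measurable [set w | b w] ->
  measurable_fun [set: T] (fun w => (b w)%:R : R).
Proof.
move=> mb; rewrite (_ : (fun w => _) = \1_[set w | b w]); last first.
  apply/funext => w; rewrite indicE; congr (nat_of_bool _)%:R.
  by apply/idP/idP => [h|]; [rewrite inE|rewrite inE].
exact: measurable_indic.
Qed.

Lemma measurable_level_ge (f : T -> R) c : measurable_fun [set: T] f ->
  measurable [set w | c <= f w].
Proof.
move=> mf; rewrite [X in measurable X](_ : _ = [set: T] `&` (f @^-1` `[c, +oo[)).
  by apply: mf => //; exact: measurable_itv.
by apply/seteqP; split => w /=; rewrite in_itv/= andbT// => -[].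
Qed.

Lemma measurable_first_passage (a : nat -> T -> R) c k :
  (forall j, (j <= k)%N -> measurable_fun [set: T] (a j)) ->
  measurable [set w | first_passage (a^~ w) c k].
Proof.
move=> ma; rewrite [X in measurable X](_ : _ = [set w | c <= a k w] `&`
    \bigcap_(j in `I_k) ~` [set w | c <= a j w]).
  apply: measurableI; first by apply: measurable_level_ge; exact: ma.
  apply: bigcap_measurableType => j /= jk; apply: measurableC.
  by apply: measurable_level_ge; apply: ma; exact: ltnW.
apply/seteqP; split => w /=.
  move=> /andP[ck /forallP h]; split => // j /= jk; apply/negP.
  by rewrite -ltNge; exact: (h (Ordinal jk)).
move=> [ck h]; rewrite /first_passage ck; apply/forallP => j.
by rewrite ltNge; apply/negP; exact: (h j (ltn_ord j)).
Qed.

Context (X Y : R -> T -> R).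
Hypothesis mX : forall t, 0 <= t -> measurable_fun [set: T] (X t).
Hypothesis mY : forall t, 0 <= t -> measurable_fun [set: T] (Y t).
Hypothesis cX : forall w, path_continuous (X^~ w).
Hypothesis cY : forall w, path_continuous (Y^~ w).

(** A description of ruin by countably many grid values, from which measurability follows. The time
    bound [n] must be chosen before the level [m]; without it the near-passages could escape to
    infinity. *)
Lemma passage_setP u w : passage_set (X^~ w) u !=set0 <->
  exists n : nat, forall m, exists N k, grid R N k <= n%:R /\
    lower_level u m <= X (grid R N k) w.
Proof.
split => [[t [t0 ut]]|[n hn]].
  exists (Num.truncn (t + 1)).+1 => m.
  have [q [N [k [-> h]]] qt] := dyadic_hit_near (@cX w) t0 ut (lower_level_lt u m) ltr01.
  by exists N, k; split => //; rewrite (le_trans qt)// ltW// truncnS_gt.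
have [||l [_ l0 _ ul]] := @bounded_dyadic_times_passage _ (X^~ w) u n%:R (@cX w).
- by move=> m; have [N [k [_ h]]] := hn m; exists (grid R N k), N, k.
- move=> m; have [N [k [kn h]]] := hn m; apply: le_trans kn.
  by apply: ge_inf; [exact: dyadic_hits_lb|exists N, k].
- by exists l.
Qed.

Lemma hitsE u : hits X u = [set w | passage_set (X^~ w) u !=set0].
Proof.
apply/seteqP; split => w; rewrite /hits /hitting_time /=.
  apply: contraPP => h; apply/negP; rewrite -leNgt.
  rewrite (_ : [set t | _] = set0) ?image_set0 ?ereal_inf0//.
  by apply/seteqP; split => // t ht; case: h; exists t.
move=> [t ht]; apply: le_lt_trans (ltry t).
by apply: ereal_inf_lbound; exists t.
Qed.

Lemma hitting_timeE u w : hits X u w ->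
  fine (hitting_time X u w) = passage_time (X^~ w) u.
Proof.
rewrite hitsE => h; rewrite /hitting_time.
by rewrite ereal_inf_EFin//; exact: passage_set_lb.
Qed.

Lemma measurable_hits u : measurable (hits X u).
Proof.
rewrite hitsE [X in measurable X](_ : _ = \bigcup_n \bigcap_m \bigcup_N
   \bigcup_(k in [set k | grid R N k <= n%:R])
     [set w | lower_level u m <= X (grid R N k) w]).
  apply: bigcupT_measurable => n; apply: bigcapT_measurable => m.
  apply: bigcupT_measurable => N; apply: bigcup_measurable => k _.
  by apply: measurable_level_ge; apply: mX; exact: grid_ge0.
apply/seteqP; split => w /=.
  move=> /passage_setP[n hn]; exists n => // m _.
  by have [N [k [h1 h2]]] := hn m; exists N => //; exists k.
move=> [n _ hn]; apply/passage_setP; exists n => m.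
by have [N _ [k /= h1 h2]] := hn m I; exists N, k.
Qed.

Lemma measurable_grid_stop c N :
  measurable_fun [set: T] (fun w => grid_stop (X^~ w) (Y^~ w) c N).
Proof.
apply: measurable_sum => k; apply: measurable_funM.
  by apply: mY; exact: grid_ge0.
apply: measurable_bool_natr.
apply: (@measurable_first_passage (fun j w => X (grid R N j) w)) => j _.
by apply: mX; exact: grid_ge0.
Qed.

Lemma grid_stop_hits_cvg u m w : hits X u w ->
  grid_stop (X^~ w) (Y^~ w) (lower_level u m) @ \oo -->
  Y (dyadic_time (X^~ w) (lower_level u m)) w.
Proof.
rewrite hitsE => h; apply: (@grid_stop_cvg _ (X^~ w) (Y^~ w)) => //.
by apply: (passage_dyadic_hits (@cX w) h); exact: lower_level_lt.
Qed.

Lemma dyadic_time_hits_cvg u w : hits X u w ->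
  (fun m => Y (dyadic_time (X^~ w) (lower_level u m)) w) @ \oo -->
  Y (passage_time (X^~ w) u) w.
Proof.
rewrite hitsE => h; have [tcvg t0 _] := dyadic_time_cvg (@cX w) h.
apply: (path_continuous_cvg (@cY w) _ t0 tcvg) => m.
apply: dyadic_time_ge0.
by apply: (passage_dyadic_hits (@cX w) h); exact: lower_level_lt.
Qed.

Lemma measurable_dyadic_stop u m : measurable_fun (hits X u)
  (fun w => Y (dyadic_time (X^~ w) (lower_level u m)) w).
Proof.
apply: (@measurable_fun_cvg _ _ _ _
  (fun N w => grid_stop (X^~ w) (Y^~ w) (lower_level u m) N)).
- by move=> N; apply: measurable_funTS; exact: measurable_grid_stop.
- by move=> w hw; exact: grid_stop_hits_cvg.
Qed.

(** A double limit of [grid_stop]: first the mesh tends to 0 at a fixed lower level, then the level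
    rises to [u]. *)
Lemma measurable_stopped u : measurable_fun (hits X u)
  (fun w => Y (fine (hitting_time X u w)) w).
Proof.
apply: (@measurable_fun_cvg _ _ _ _
  (fun m w => Y (dyadic_time (X^~ w) (lower_level u m)) w)).
- by move=> m; exact: measurable_dyadic_stop.
- by move=> w hw; rewrite hitting_timeE//; exact: dyadic_time_hits_cvg.
Qed.

Context (P : probability T R).

Lemma fatou_cvg (D : set T) (f : nat -> T -> R) (g : T -> R) (K : \bar R) :
  measurable D -> (forall n, measurable_fun D (f n)) ->
  (forall n w, D w -> 0 <= f n w) ->
  (forall w, D w -> f^~ w @ \oo --> g w) ->
  (forall n, \int[P]_(w in D) (f n w)%:E <= K)%E ->
  (\int[P]_(w in D) (g w)%:E <= K)%E.
Proof.
move=> mD mf f0 fg fK.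
have -> : (\int[P]_(w in D) (g w)%:E =
    \int[P]_(w in D) limn_einf (fun n => (f n w)%:E))%E.
  apply: eq_integral => w; rewrite inE => Dw.
  have cv : (fun n => (f n w)%:E) @ \oo --> (g w)%:E.
    by apply: cvg_EFin; [exact: nearW|exact: fg].
  rewrite is_cvg_limn_einfE; first by apply/esym/cvg_lim.
  by apply/cvg_ex; exists (g w)%:E.
apply: (le_trans (fatou P mD _ _)).
- by move=> n; exact/measurable_EFinP.
- by move=> n w Dw; rewrite lee_fin f0.
rewrite limn_einf_lim; apply: lime_le; first exact: is_cvg_einfs.
apply: nearW => n; apply: le_trans (fK n).
by apply: ereal_inf_lbound; exists n => /=.
Qed.

Hypothesis Y0 : forall t w, 0 <= Y t w.

(** Fatou along the two limits of [measurable_stopped]. *)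
Lemma integral_stopped_le u (K : \bar R) :
  (forall c N, \int[P]_w (grid_stop (X^~ w) (Y^~ w) c N)%:E <= K)%E ->
  (\int[P]_(w in hits X u) (Y (fine (hitting_time X u w)) w)%:E <= K)%E.
Proof.
move=> hK; have mh := measurable_hits u.
apply: (@fatou_cvg _ (fun m w => Y (dyadic_time (X^~ w) (lower_level u m)) w)) => //.
- by move=> m; exact: measurable_dyadic_stop.
- by move=> w hw; rewrite hitting_timeE//; exact: dyadic_time_hits_cvg.
move=> m; have gs0 N w : 0 <= grid_stop (X^~ w) (Y^~ w) (lower_level u m) N.
  by apply: sumr_ge0 => k _; rewrite mulr_ge0.
apply: (@fatou_cvg _
  (fun N w => grid_stop (X^~ w) (Y^~ w) (lower_level u m) N)) => //.
- by move=> N; apply: measurable_funTS; exact: measurable_grid_stop.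
- by move=> w hw; exact: grid_stop_hits_cvg.
move=> N; apply: le_trans (hK (lower_level u m) N).
apply: ge0_subset_integral => //.
- by apply/measurable_EFinP; exact: measurable_grid_stop.
- by move=> w _; rewrite lee_fin.
Qed.

End processes.

(** * Exponential martingales of a Brownian motion *)

Section portfolio_def.
Context (R : realType) (disp : measure_display) (T : measurableType disp) (d : nat).
Context (Sigma : 'M[R]_d) (r_ : 'I_d -> R).
Implicit Types (B : 'I_d -> R -> T -> R) (a b th : 'I_d -> R).

(** One weighted sum serves both as the process being monitored, with weights [a], and as the
    exponent of the martingale, with weights [th]. *)
Definition portfolio B a (t : R) (w : T) : R :=
  \sum_(i < d) a i * (r_ i * t + B i t w).

Definition drift a : R := \sum_(i < d) a i * r_ i.

Definition qform a b : R := \sum_(i < d) \sum_(j < d) a i * b j * Sigma i j.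

(** The function [psi] of the overview. *)
Definition laplace_exponent th : R := drift th + qform th th / 2.

Definition exp_martingale B th (t : R) (w : T) : R :=
  expR (portfolio B th t w - laplace_exponent th * t).

(** The Brownian motion starts at 0 only almost surely. The centered version does so for every [w],
    and it is a function of the increments alone, hence measurable with respect to the past. *)
Definition centered B (i : 'I_d) (t : R) (w : T) : R := B i t w - B i 0 w.

Definition increment B (t : nat -> R) (l : nat) (w : T) : d.-tuple R :=
  [tuple B i (t l.+1) w - B i (t l) w | i < d].

Lemma exp_martingale_ge0 B th t w : 0 <= exp_martingale B th t w.
Proof. exact: expR_ge0. Qed.

Lemma portfolio_centered0 B a w : portfolio (centered B) a 0 w = 0.
Proof.
by rewrite /portfolio big1// => i _; rewrite /centered subrr mulr0 addr0 mulr0.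
Qed.

Lemma portfolio_centered B a t w : (forall i, B i 0 w = 0) ->
  portfolio (centered B) a t w = portfolio B a t w.
Proof.
by move=> B0; apply: eq_bigr => i _; rewrite /centered B0 subr0.
Qed.

Lemma drift_scale (c : R) a : drift (fun i => c * a i) = c * drift a.
Proof. by rewrite /drift mulr_sumr; apply: eq_bigr => i _; rewrite mulrA. Qed.

Lemma portfolio_scale B (c : R) a t w :
  portfolio B (fun i => c * a i) t w = c * portfolio B a t w.
Proof. by rewrite /portfolio mulr_sumr; apply: eq_bigr => i _; rewrite mulrA. Qed.

Lemma qform_scale (c : R) a :
  qform (fun i => c * a i) (fun i => c * a i) = c ^+ 2 * qform a a.
Proof.
rewrite /qform mulr_sumr; apply: eq_bigr => i _.
by rewrite mulr_sumr; apply: eq_bigr => j _; ring.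
Qed.

(** The drift cancels, so the second factor depends on the Brownian increment after [s] only. *)
Lemma exp_martingale_mul B th s t w :
  exp_martingale B th t w = exp_martingale B th s w *
    expR (\sum_i th i * (B i t w - B i s w) - (t - s) * qform th th / 2).
Proof.
rewrite -expRD; congr expR.
have -> : \sum_i th i * (B i t w - B i s w) =
    portfolio B th t w - portfolio B th s w - drift th * (t - s).
  rewrite /portfolio /drift mulr_suml -!sumrB; apply: eq_bigr => i _; ring.
by rewrite /laplace_exponent; field.
Qed.

End portfolio_def.

Section brownian.
Context (R : realType) (disp : measure_display) (T : measurableType disp).
Context (P : probability T R) (d : nat) (Sigma : 'M[R]_d) (r_ : 'I_d -> R).
Context (B : 'I_d -> R -> T -> R) (hB : brownian_motion P Sigma B).
Implicit Types (a th : 'I_d -> R) (t : nat -> R).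

Lemma brownian_measurable i s : 0 <= s -> measurable_fun [set: T] (B i s).
Proof. by case: hB => mB _ _ _ _; exact: mB. Qed.

Lemma brownian_path_continuous i w : path_continuous (fun s => B i s w).
Proof. by case: hB => _ _ cB _ _; exact: cB. Qed.

Lemma portfolio_measurable a s : 0 <= s -> measurable_fun [set: T] (portfolio r_ B a s).
Proof.
move=> s0; apply: measurable_sum => i; apply: measurable_funM => //.
by apply: measurable_funD => //; exact: brownian_measurable.
Qed.

Lemma centered_measurable i s : 0 <= s -> measurable_fun [set: T] (centered B i s).
Proof. by move=> s0; apply: measurable_funB; exact: brownian_measurable. Qed.

Lemma portfolio0_measurable a s : 0 <= s ->
  measurable_fun [set: T] (portfolio r_ (centered B) a s).
Proof.
move=> s0; apply: measurable_sum => i; apply: measurable_funM => //.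
by apply: measurable_funD => //; exact: centered_measurable.
Qed.

Lemma exp_martingale_measurable th s : 0 <= s ->
  measurable_fun [set: T] (exp_martingale Sigma r_ B th s).
Proof.
move=> s0; apply: measurableT_comp => //.
by apply: measurable_funB => //; exact: portfolio_measurable.
Qed.

Lemma exp_martingale0_measurable th s : 0 <= s ->
  measurable_fun [set: T] (exp_martingale Sigma r_ (centered B) th s).
Proof.
move=> s0; apply: measurableT_comp => //.
by apply: measurable_funB => //; exact: portfolio0_measurable.
Qed.

Lemma path_continuous_lin (x y : R -> R) (p q : R) :
  path_continuous x -> path_continuous y ->
  path_continuous (fun s => p * x s + q * y s).
Proof.
move=> cx cy s; apply: cvgD; apply: cvgM; try exact: cvg_cst; [exact: cx|exact: cy].
Qed.

Lemma path_continuous_id : path_continuous (fun s : R => s).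
Proof. by apply: continuous_subspaceT => s; exact: cvg_id. Qed.

Lemma path_continuous_cst (c : R) : path_continuous (fun=> c).
Proof. by move=> s; exact: cvg_cst. Qed.

Lemma path_continuous_sum (I : finType) (x : I -> R -> R) (p : I -> R) :
  (forall i, path_continuous (x i)) -> path_continuous (fun s => \sum_i p i * x i s).
Proof.
move=> cx; elim: (index_enum I) => [|i l IH].
  by under eq_fun do rewrite big_nil; exact: path_continuous_cst.
rewrite (_ : (fun s => _) = (fun s => p i * x i s + 1 * \sum_(j <- l) p j * x j s)).
  exact: path_continuous_lin.
by apply/funext => s; rewrite big_cons mul1r.
Qed.

Lemma asset_path_continuous i w : path_continuous (fun s => r_ i * s + B i s w).
Proof.
rewrite (_ : (fun s => _) = (fun s => r_ i * s + 1 * B i s w)); last first.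
  by apply/funext => s; rewrite mul1r.
apply: path_continuous_lin; first exact: path_continuous_id.
exact: brownian_path_continuous.
Qed.

Lemma portfolio_path_continuous a w : path_continuous (fun s => portfolio r_ B a s w).
Proof. by apply: path_continuous_sum => i; exact: asset_path_continuous. Qed.

Lemma portfolio0_path_continuous a w :
  path_continuous (fun s => portfolio r_ (centered B) a s w).
Proof.
apply: path_continuous_sum => i.
rewrite (_ : (fun s => _) = (fun s => 1 * (r_ i * s + B i s w) + 1 * (- B i 0 w))).
  apply: path_continuous_lin; [exact: asset_path_continuous|exact: path_continuous_cst].
by apply/funext => s; rewrite /centered; ring.
Qed.

Lemma exp_martingale_path_continuous th w :
  path_continuous (fun s => exp_martingale Sigma r_ B th s w).
Proof.
have c : path_continuous (fun s => 1 * portfolio r_ B th s w +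
    (- laplace_exponent Sigma r_ th) * s).
  by apply: path_continuous_lin; [exact: portfolio_path_continuous|exact: path_continuous_id].
rewrite (_ : (fun s => _) = expR \o (fun s => 1 * portfolio r_ B th s w +
    (- laplace_exponent Sigma r_ th) * s)).
  move=> s; apply: (@continuous_cvg _ _ _ _ _ _ (@expR R)); first exact: continuous_expR.
  exact: c.
by apply/funext => v; congr expR; ring.
Qed.

Lemma brownian_increment_mgf th s s' : 0 <= s -> s <= s' ->
  (\int[P]_w (expR (\sum_i th i * (B i s' w - B i s w) -
                    (s' - s) * qform Sigma th th / 2))%:E = 1)%E.
Proof.
move=> s0 ss'; have s'0 : 0 <= s' by exact: le_trans ss'.
case: hB => mB _ _ _ /(_ _ _ s0 ss') gv.
have mD i : measurable_fun [set: T] (fun w => B i s' w - B i s w).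
  by apply: measurable_funB; exact: mB.
have h := gaussian_vector_mgf mD gv th.
under eq_integral do rewrite expRD mulrC EFinM.
have mexp : measurable_fun [set: T]
    (fun w => (expR (\sum_i th i * (B i s' w - B i s w)))%:E).
  apply/measurable_EFinP; apply: measurableT_comp => //.
  by apply: measurable_sum => i; exact: measurable_funM.
rewrite ge0_integralZl//.
rewrite h -EFinM -expRD -[RHS]/(1%:E) -(expR0 R); congr (expR _)%:E.
rewrite (_ : \sum_i _ = (s' - s) * qform Sigma th th); first by ring.
rewrite /qform mulr_sumr; apply: eq_bigr => i _; rewrite mulr_sumr.
by apply: eq_bigr => j _; rewrite mxE; ring.
Qed.

Lemma increment_measurable t l : (forall j, 0 <= t j) ->
  measurable_fun [set: T] (increment B t l).
Proof.
move=> t0; apply/measurable_fun_tnthP => i.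
rewrite (_ : _ \o _ = fun w => B i (t l.+1) w - B i (t l) w).
  by apply: measurable_funB; exact: brownian_measurable.
by apply/funext => w /=; rewrite tnth_mktuple.
Qed.

Lemma past_portfolio_measurable t k j a : t 0%N = 0 -> (j <= k)%N ->
  measurable_fun [set: g_sigma_algebraType (past_rect (increment B t) k)]
    (portfolio r_ (centered B) a (t j) :
       g_sigma_algebraType (past_rect (increment B t) k) -> R).
Proof.
move=> t00 jk.
rewrite (_ : portfolio _ _ _ _ = fun w => \sum_i a i * (r_ i * t j +
    \sum_(l < j) tnth (increment B t l w) i)); last first.
  apply/funext => w; apply: eq_bigr => i _; congr (_ * (_ + _)).
  under eq_bigr do rewrite tnth_mktuple.
  rewrite -(big_mkord xpredT (fun l => B i (t l.+1) w - B i (t l) w)).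
  by rewrite telescope_sumr// t00.
apply: measurable_sum => i; apply: measurable_funM => //.
apply: measurable_funD => //; apply: measurable_sum => l.
apply: (measurableT_comp (measurable_tnth i)).
by apply: past_measurable_xi; exact: leq_trans (ltn_ord l) jk.
Qed.

(** The martingale property over one step, tested on an event of the past: the multiplicative
    increment is independent of that past and has mean 1. *)
Lemma exp_martingale_past th t k (b : T -> bool) :
  t 0%N = 0 -> nondecreasing_seq t ->
  measurable ([set w | b w] : set (g_sigma_algebraType (past_rect (increment B t) k))) ->
  (\int[P]_w (exp_martingale Sigma r_ (centered B) th (t k.+1) w * (b w)%:R)%:E =
   \int[P]_w (exp_martingale Sigma r_ (centered B) th (t k) w * (b w)%:R)%:E)%E.
Proof.
move=> t00 nt mb; have t0 j : 0 <= t j by rewrite -t00; exact: nt.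
pose E := g_sigma_algebraType (past_rect (increment B t) k).
have mxi l : measurable_fun [set: T] (increment B t l) by exact: increment_measurable.
pose f (w : E) := (exp_martingale Sigma r_ (centered B) th (t k) w * (b w)%:R)%:E.
pose g (v : d.-tuple R) := (expR (\sum_i th i * tnth v i -
  (t k.+1 - t k) * qform Sigma th th / 2))%:E.
have mf : measurable_fun [set: E] f.
  apply/measurable_EFinP; apply: measurable_funM; last exact: measurable_bool_natr.
  apply: measurableT_comp => //; apply: measurable_funB => //.
  exact: past_portfolio_measurable.
have mg : measurable_fun [set: d.-tuple R] g.
  apply/measurable_EFinP; apply: measurableT_comp => //; apply: measurable_funB => //.
  apply: measurable_sum => i; apply: measurable_funM => //; exact: measurable_tnth.
transitivity (\int[P]_w (f w * g (increment B t k w)))%E.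
  apply: eq_integral => w _.
  have e : \sum_i th i * tnth (increment B t k w) i =
      \sum_i th i * (centered B i (t k.+1) w - centered B i (t k) w).
    by apply: eq_bigr => i _; rewrite tnth_mktuple /centered; congr (_ * _); ring.
  have eM := exp_martingale_mul Sigma r_ (centered B) th (t k) (t k.+1) w.
  by rewrite /f /g e -EFinM eM mulrAC.
(* The past enters as the identity map into the same space carrying the smaller sigma-algebra. *)
rewrite (@ge0_integral_indep _ _ _ P _ _ E _ (fun w => w) (increment B t k))//.
- rewrite [X in (_ * X)%E](_ : _ = 1)%E ?mule1//.
  rewrite -(brownian_increment_mgf th (t0 k) (nt _ _ (leqnSn k))).
  apply: eq_integral => w _.
  have e : \sum_i th i * tnth (increment B t k w) i =
      \sum_i th i * (B i (t k.+1) w - B i (t k) w).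
    by apply: eq_bigr => i _; rewrite tnth_mktuple.
  by rewrite /g e.
- by move=> _ A mA; rewrite setTI; exact: (past_rect_sub mxi mA).
- move=> A C mA mC; case: hB => _ _ _ ind _.
  by apply: (past_rect_indep mxi) => //; exact: ind.
- by move=> w; rewrite lee_fin mulr_ge0// expR_ge0.
- by move=> v; rewrite lee_fin expR_ge0.
Qed.

(** Follows the grid up to index [k], then jumps to the horizon [n]: the step from [k] to [k + 1]
    then covers all the remaining time, and one use of [exp_martingale_past] suffices. *)
Definition grid_upto (N k n l : nat) : R :=
  if (l <= k)%N then grid R N l else grid R N n.

(** The event is determined by the increments before [k]. The cap [c'] limits the overshoot: it is
    [u + eta] in the lower bound for ruin, and is sent to infinity in [grid_stop_centered_le1]. *)
Lemma exp_martingale_first_passage th a c c' (N k n : nat) : (k <= n)%N ->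
  let b w := first_passage (fun j => portfolio r_ (centered B) a (grid R N j) w) c k &&
     (portfolio r_ (centered B) a (grid R N k) w <= c') in
  (\int[P]_w (exp_martingale Sigma r_ (centered B) th (grid R N n) w * (b w)%:R)%:E =
   \int[P]_w (exp_martingale Sigma r_ (centered B) th (grid R N k) w * (b w)%:R)%:E)%E.
Proof.
move=> kn b; pose t := grid_upto N k n.
have t00 : t 0%N = 0 by rewrite /t /grid_upto /grid mul0r.
have nt : nondecreasing_seq t.
  move=> i j ij; rewrite /t /grid_upto; case: (leqP j k) => jk.
    by rewrite (leq_trans ij jk) grid_le.
  by case: (leqP i k) => ik; rewrite grid_le// (leq_trans ik).
have tk : t k = grid R N k by rewrite /t /grid_upto leqnn.
have tk1 : t k.+1 = grid R N n by rewrite /t /grid_upto ltnn.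
have tj j : (j <= k)%N -> t j = grid R N j by rewrite /t /grid_upto => ->.
rewrite -tk -tk1; apply: exp_martingale_past => //.
pose E := g_sigma_algebraType (past_rect (increment B t) k).
have mp j : (j <= k)%N -> measurable_fun [set: E]
    (portfolio r_ (centered B) a (grid R N j) : E -> R).
  by move=> jk; rewrite -tj//; exact: past_portfolio_measurable.
rewrite (_ : [set w | b w] = [set w : E | first_passage (fun j =>
    portfolio r_ (centered B) a (grid R N j) w) c k] `&` ~` (
    [set: E] `&` (portfolio r_ (centered B) a (grid R N k) : E -> R) @^-1` `]c', +oo[)).
  apply: measurableI.
    by apply: (@measurable_first_passage _ _ E
      (fun j w => portfolio r_ (centered B) a (grid R N j) w)).
  by apply: measurableC; apply: (mp k (leqnn k)) => //; exact: measurable_itv.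
apply/seteqP; split => w; rewrite /b /= in_itv/= andbT.
  by move=> /andP[-> h]; split => // -[_]; rewrite ltNge h.
by move=> [-> h]; rewrite leNgt; apply/negP => h'; exact: h.
Qed.

End brownian.

(** * Stopping along the dyadic grid *)

Section first_passage_bounds.
Context (R : realType) (disp : measure_display) (T : measurableType disp).
Context (P : probability T R) (d : nat) (Sigma : 'M[R]_d) (r_ : 'I_d -> R).
Context (B : 'I_d -> R -> T -> R) (hB : brownian_motion P Sigma B).
Implicit Types (a th : 'I_d -> R).

Let S a t w := portfolio r_ B a t w.
Let S0 a t w := portfolio r_ (centered B) a t w.
Let M0 th t w := exp_martingale Sigma r_ (centered B) th t w.

Lemma ae_centered : {ae P, forall w, forall i, B i 0 w = 0}.
Proof. by case: hB. Qed.

Lemma expectation_exp_martingale th t : 0 <= t -> (\int[P]_w (M0 th t w)%:E = 1)%E.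
Proof.
move=> t0; rewrite -(brownian_increment_mgf hB th (lexx 0) t0).
apply: eq_integral => w _; congr EFin.
rewrite /M0 (exp_martingale_mul _ _ _ _ 0).
rewrite /exp_martingale portfolio_centered0 mulr0 subrr expR0 mul1r.
have -> : \sum_i th i * (centered B i t w - centered B i 0 w) =
    \sum_i th i * (B i t w - B i 0 w).
  by apply: eq_bigr => i _; rewrite /centered subrr subr0.
by [].
Qed.

Lemma integrable_exp_martingale th t : 0 <= t ->
  P.-integrable [set: T] (fun w => (M0 th t w)%:E).
Proof.
move=> t0; apply/integrableP; split.
  by apply/measurable_EFinP; exact: (exp_martingale0_measurable _ hB).
under eq_integral do rewrite gee0_abs ?lee_fin ?exp_martingale_ge0//.
by rewrite expectation_exp_martingale// ltry.
Qed.

Let fp a c N k w := first_passage (fun j => S0 a (grid R N j) w) c k.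

Lemma mS0 a t : 0 <= t -> measurable_fun [set: T] (S0 a t).
Proof. exact: (portfolio0_measurable _ hB). Qed.

Lemma mfp a c N k : measurable [set w | fp a c N k w].
Proof.
apply: (@measurable_first_passage _ _ _ (fun j w => S0 a (grid R N j) w)) => j _.
by apply: mS0; exact: grid_ge0.
Qed.

Lemma mfp' a c c' N k :
  measurable [set w | fp a c N k w && (S0 a (grid R N k) w <= c')].
Proof.
rewrite (_ : [set w | _] = [set w | fp a c N k w] `&`
   [set w | - c' <= - S0 a (grid R N k) w]); last first.
  by apply/seteqP; split => w /=; rewrite lerN2 => /andP.
apply: measurableI; first exact: mfp.
apply: (@measurable_level_ge _ _ _ (fun w => - S0 a (grid R N k) w)).
by apply: measurableT_comp => //; apply: mS0; exact: grid_ge0.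
Qed.

Lemma sum_first_passage_le1 a c N n w : \sum_(k < n.+1) (fp a c N k w)%:R <= 1 :> R.
Proof.
have [[k fk]|nf] := pselect (exists k : 'I_n.+1, fp a c N k w).
  have := @sum_first_passage R (fun j => S0 a (grid R N j) w) (fun=> 1) c n.+1 k
    (ltn_ord k) fk.
  by under eq_bigr do rewrite mul1r; move=> ->.
rewrite big1 // => k _; case: (boolP (fp a c N k w)) => // fk.
by exfalso; apply: nf; exists k.
Qed.

(** Optional stopping on a finite grid: on first passage at [k], the value at [k] may be replaced by
    the value at the horizon; these events are disjoint, so the sum is at most the full expectation
    1. *)
Lemma grid_stop_centered_le1 a th c N :
  (\int[P]_w (grid_stop (fun t => S0 a t w) (fun t => M0 th t w) c N)%:E <= 1)%E.
Proof.
set n := (N * 2 ^ N)%N.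
have mM k : measurable_fun [set: T] (M0 th (grid R N k)).
  by apply: (exp_martingale0_measurable _ hB); exact: grid_ge0.
have bE k w : fp a c N k w =
    fp a c N k w && (S0 a (grid R N k) w <= S0 a (grid R N k) w).
  by rewrite lexx andbT.
have step (k : 'I_n.+1) :
    (\int[P]_w (M0 th (grid R N k) w * (fp a c N k w)%:R)%:E =
     \int[P]_w (M0 th (grid R N n) w * (fp a c N k w)%:R)%:E)%E.
  apply/esym.
  pose I (j m : nat) : \bar R := (\int[P]_w (M0 th (grid R N j) w *
      (fp a c N k w && (S0 a (grid R N k) w <= m%:R))%:R)%:E)%E.
  have lim (m : nat) : I n m = I k m.
    by apply: (exp_martingale_first_passage _ hB); rewrite -ltnS ltn_ord.
  have cv (j : nat) : I j @ \oo --> (\int[P]_w (M0 th (grid R N j) w * (fp a c N k w)%:R)%:E)%E.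
    apply: (@dominated_cvg _ _ _ P _ measurableT (fun (m : nat) w =>
        (M0 th (grid R N j) w *
         (fp a c N k w && (S0 a (grid R N k) w <= m%:R))%:R)%:E) _
      (fun w => (M0 th (grid R N j) w)%:E)) => //.
    - move=> m; apply/measurable_EFinP; apply: measurable_funM => //.
      exact: (measurable_bool_natr (mfp' a c m%:R N k)).
    - move=> w _; apply: cvg_near_cst.
      exists (Num.truncn (S0 a (grid R N k) w)).+1 => // m /= hm.
      rewrite (_ : S0 _ _ _ <= _) ?andbT//.
      by rewrite (le_trans (ltW (truncnS_gt _)))// ler_nat.
    - by apply: integrable_exp_martingale; exact: grid_ge0.
    - move=> m w _; rewrite lee_fin ger0_norm ?mulr_ge0 ?expR_ge0//.
      by rewrite ler_piMr ?expR_ge0//; case: (_ && _).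
  have cvk := cv k; rewrite (_ : I k = I n) in cvk; last by apply/funext => m.
  exact: (cvg_unique _ (cv n) cvk).
rewrite /grid_stop -/n; under eq_integral do rewrite -sumEFin.
rewrite ge0_integral_sum//; last 2 first.
- move=> k; apply/measurable_EFinP; apply: measurable_funM => //.
  exact: (measurable_bool_natr (mfp a c N k)).
- by move=> k w _; rewrite lee_fin mulr_ge0// expR_ge0.
under eq_bigr do rewrite step.
rewrite -ge0_integral_sum//; last 2 first.
- move=> k; apply/measurable_EFinP; apply: measurable_funM => //.
  exact: (measurable_bool_natr (mfp a c N k)).
- by move=> k w _; rewrite lee_fin mulr_ge0// expR_ge0.
rewrite -(expectation_exp_martingale th (grid_ge0 R N n)).
apply: ge0_le_integral => //.
- by move=> w _; apply: sume_ge0 => k _; rewrite lee_fin mulr_ge0// expR_ge0.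
- apply: emeasurable_sum => k; apply/measurable_EFinP; apply: measurable_funM => //.
  exact: (measurable_bool_natr (mfp a c N k)).
- exact/measurable_EFinP.
- move=> w _; rewrite sumEFin lee_fin -mulr_sumr ler_piMr ?expR_ge0//.
  exact: sum_first_passage_le1.
Qed.

Lemma grid_stop_exp_martingale_le1 a th c N :
  (\int[P]_w (grid_stop (fun t => S a t w)
     (fun t => exp_martingale Sigma r_ B th t w) c N)%:E <= 1)%E.
Proof.
rewrite (le_trans _ (grid_stop_centered_le1 a th c N))// le_eqVlt.
apply/orP; left; apply/eqP; apply: ae_eq_integral => //.
- apply/measurable_EFinP; apply: (@measurable_grid_stop _ _ _ (S a)
    (exp_martingale Sigma r_ B th)) => t t0.
    exact: (portfolio_measurable _ hB).
  exact: (exp_martingale_measurable _ hB).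
- apply/measurable_EFinP; apply: (@measurable_grid_stop _ _ _ (S0 a) (M0 th)) => t t0.
    exact: mS0.
  exact: (exp_martingale0_measurable _ hB).
- apply: filterS ae_centered => w B0 _; congr EFin; apply: eq_bigr => k _.
  rewrite /M0 /exp_martingale portfolio_centered//.
  rewrite (_ : (fun j => S a _ w) = (fun j => S0 a (grid R N j) w))//.
  by apply/funext => j; rewrite /S0 portfolio_centered.
Qed.

Lemma exp_martingale_hits_le1 a th u :
  (\int[P]_(w in hits (S a) u)
     (exp_martingale Sigma r_ B th (fine (hitting_time (S a) u w)) w)%:E <= 1)%E.
Proof.
apply: integral_stopped_le.
- by move=> t t0; exact: (portfolio_measurable _ hB).
- by move=> t t0; exact: (exp_martingale_measurable _ hB).
- by move=> w; exact: (portfolio_path_continuous hB).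
- by move=> w; exact: (exp_martingale_path_continuous hB).
- by move=> t w; exact: exp_martingale_ge0.
- by move=> c N; exact: grid_stop_exp_martingale_le1.
Qed.

Lemma P_hits_centered a u : P (hits (S a) u) = P (hits (S0 a) u).
Proof.
have mh : measurable (hits (S a) u).
  apply: measurable_hits => [t t0|w]; first exact: (portfolio_measurable _ hB).
  exact: (portfolio_path_continuous hB).
have mh0 : measurable (hits (S0 a) u).
  apply: measurable_hits => [t t0|w]; first exact: mS0.
  exact: (portfolio0_path_continuous hB).
have PI (A : set T) : measurable A -> P A = (\int[P]_w (\1_A w)%:E)%E.
  by move=> mA; rewrite integral_indic// setIT.
rewrite (PI _ mh) (PI _ mh0); apply: ae_eq_integral => //.
- by apply/measurable_EFinP; exact: measurable_indic.
- by apply/measurable_EFinP; exact: measurable_indic.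
- apply: filterS ae_centered => w B0 _; congr EFin; rewrite !indicE.
  have e : [set t : R | 0 <= t /\ u <= S a t w] = [set t : R | 0 <= t /\ u <= S0 a t w].
    by apply/seteqP; split => t /=; rewrite /S0 portfolio_centered.
  congr (nat_of_bool _)%:R; apply/idP/idP => /set_mem h; apply/mem_set; move: h;
    by rewrite /hits /hitting_time /= e.
Qed.

End first_passage_bounds.

(** * Ruin probability and value at risk *)

Section ruin_probability.
Context (R : realType) (disp : measure_display) (T : measurableType disp).
Context (P : probability T R) (d : nat) (Sigma : 'M[R]_d) (r_ : 'I_d -> R).
Context (B : 'I_d -> R -> T -> R) (hB : brownian_motion P Sigma B).
Context (a : 'I_d -> R).

Let S t w := portfolio r_ B a t w.
Let S0 t w := portfolio r_ (centered B) a t w.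
Let M0 th t w := exp_martingale Sigma r_ (centered B) th t w.
Let fp u N k w := first_passage (fun j => S0 (grid R N j) w) u k.

Lemma laplace_exponent_scale (c : R) :
  laplace_exponent Sigma r_ (fun i => c * a i) =
  c * drift r_ a + c ^+ 2 * qform Sigma a a / 2.
Proof. by rewrite /laplace_exponent drift_scale qform_scale. Qed.

Lemma exp_martingale_scaleE (c : R) t w :
  M0 (fun i => c * a i) t w =
  expR (c * S0 t w - laplace_exponent Sigma r_ (fun i => c * a i) * t).
Proof. by rewrite /M0 /exp_martingale portfolio_scale. Qed.

Lemma hits_portfolio_measurable u : measurable (hits S u).
Proof.
apply: measurable_hits => [t t0|w]; first exact: (portfolio_measurable _ hB).
exact: (portfolio_path_continuous hB).
Qed.

Lemma hits_portfolio0_measurable u : measurable (hits S0 u).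
Proof.
apply: measurable_hits => [t t0|w]; first exact: (portfolio0_measurable _ hB).
exact: (portfolio0_path_continuous hB).
Qed.

Context (c0 : R) (c0_ge0 : 0 <= c0).
Context (psi_c0 : laplace_exponent Sigma r_ (fun i => c0 * a i) = 0).

(* Splits [E M_h = 1] according to whether the first passage of [u] along the
   grid happens before the horizon [h], and whether it overshoots by [eta]. *)
Lemma ruin_lower_bound_horizon u (eta eps : R) (h : nat) :
  0 < u -> 0 < eta -> 0 < eps ->
  1 <= expR (c0 * (u + eta)) * fine (P (hits S0 u)) + eps +
       expR (c0 * u / 2 +
             laplace_exponent Sigma r_ (fun i => c0 / 2 * a i) * h%:R).
Proof.
move=> u0 eta0 eps0.
set psi2 := laplace_exponent Sigma r_ (fun i => c0 / 2 * a i).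
pose th := fun i => c0 * a i; pose M w := M0 th h%:R w.
pose n N := (h * 2 ^ N)%N.
have gn N : grid R N (n N) = h%:R by rewrite /grid natrM natrX mulfK// expf_neq0.
have M_ge0 w : 0 <= M w by exact: expR_ge0.
have mM th' t : 0 <= t -> measurable_fun [set: T] (M0 th' t).
  by move=> t0; exact: (exp_martingale0_measurable _ hB).
have iM : P.-integrable [set: T] (fun w => (M w)%:E).
  exact: (integrable_exp_martingale _ hB).
(* The three cases are passage with small overshoot, passage with large overshoot, and a path below
   [u] at the horizon. They cover the space, since a path with [u <= S0 h] has a first passage by
   then; they may overlap, whence the inequality in [split3]. *)
pose b1 N k w := fp u N k w && (S0 (grid R N k) w <= u + eta).
pose b2 N w := [exists k : 'I_(n N).+1, fp u N k w && ~~ (S0 (grid R N k) w <= u + eta)].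
pose b3 w := ~~ (u <= S0 h%:R w).
have mb1 N k : measurable [set w | b1 N k w] by exact: (mfp' _ hB).
have mf1 N k : measurable_fun [set: T] (fun w => M w * (b1 N k w)%:R).
  by apply: measurable_funM; [exact: mM|exact: measurable_bool_natr].
have mb2 N : measurable [set w | b2 N w].
  rewrite (_ : [set w | _] = \bigcup_(k in `I_(n N).+1)
      ([set w | fp u N k w] `\` [set w | b1 N k w])).
    apply: bigcup_measurable => k _; apply: measurableD => //.
    exact: (mfp _ hB).
  apply/seteqP; split => w /=.
    move=> /existsP[k /andP[fk nk]]; exists k => /=; first exact: ltn_ord.
    by split => //; rewrite /b1 (negbTE nk) andbF.
  move=> [k kn [fk nk]]; apply/existsP; exists (Ordinal kn) => /=.
  apply/andP; split; first exact: fk.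
  by apply/negP => h'; apply: nk; rewrite /= /b1; apply/andP; split.
have mf2 N : measurable_fun [set: T] (fun w => M w * (b2 N w)%:R).
  by apply: measurable_funM; [exact: mM|exact: measurable_bool_natr].
have mb3 : measurable [set w | b3 w].
  rewrite (_ : [set w | _] = ~` [set w | u <= S0 h%:R w]).
    apply: measurableC; apply: measurable_level_ge.
    exact: (portfolio0_measurable _ hB).
  by apply/seteqP; split => w /=; rewrite /b3 => /negP.
have mf3 : measurable_fun [set: T] (fun w => M w * (b3 w)%:R).
  by apply: measurable_funM; [exact: mM|exact: measurable_bool_natr].
pose I1 N := (\int[P]_w (\sum_(k < (n N).+1) (M w * (b1 N k w)%:R)%:E))%E.
pose I2 N := (\int[P]_w (M w * (b2 N w)%:R)%:E)%E.
pose I3 := (\int[P]_w (M w * (b3 w)%:R)%:E)%E.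
have split3 N : (1 <= I1 N + I2 N + I3)%E.
  have sum0 w : (0 <= \sum_(k < (n N).+1) (M w * (b1 N k w)%:R)%:E)%E.
    by apply: sume_ge0 => k _; rewrite lee_fin mulr_ge0.
  have msum : measurable_fun [set: T] (fun w =>
      \sum_(k < (n N).+1) (M w * (b1 N k w)%:R)%:E)%E.
    by apply: emeasurable_sum => k; exact/measurable_EFinP.
  have e2 w : (0 <= (M w * (b2 N w)%:R)%:E)%E by rewrite lee_fin mulr_ge0.
  have e3 w : (0 <= (M w * (b3 w)%:R)%:E)%E by rewrite lee_fin mulr_ge0.
  have me2 : measurable_fun [set: T] (fun w => (M w * (b2 N w)%:R)%:E).
    exact/measurable_EFinP.
  have me3 : measurable_fun [set: T] (fun w => (M w * (b3 w)%:R)%:E).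
    exact/measurable_EFinP.
  rewrite /I1 /I2 /I3 -ge0_integralD// -ge0_integralD//; first last.
  - exact: emeasurable_funD.
  - by move=> w _; rewrite adde_ge0.
  rewrite -(expectation_exp_martingale r_ hB th (ler0n R h)).
  apply: ge0_le_integral => //.
  - by move=> w _; rewrite lee_fin expR_ge0.
  - exact: (measurable_int P iM).
  - by apply: emeasurable_funD => //; exact: emeasurable_funD.
  move=> w _; rewrite -/(M w).
  have [uh|uh] := boolP (u <= S0 h%:R w); last first.
    by rewrite /b3 uh mulr1 leeDr// adde_ge0.
  have : u <= S0 (grid R N (n N)) w by rewrite gn.
  move=> /(first_passageP (a := fun j => S0 (grid R N j) w))[j jn fj].
  have [ju|ju] := boolP (S0 (grid R N j) w <= u + eta).
    rewrite -addeA; apply: lee_paddr; first by rewrite adde_ge0.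
    have jn' : (j < (n N).+1)%N by rewrite ltnS.
    rewrite (bigD1 (Ordinal jn'))//= /b1 /fp fj ju mulr1 leeDl//.
    by apply: sume_ge0 => k _; rewrite lee_fin mulr_ge0.
  rewrite -addeA addeCA; apply: lee_paddr; first by rewrite adde_ge0.
  rewrite (_ : b2 N w = true) ?mulr1//; apply/existsP.
  have jn' : (j < (n N).+1)%N by rewrite ltnS.
  by exists (Ordinal jn') => /=; rewrite /fp fj ju.
(* Moved back to the passage, the martingale has no time factor because [psi] vanishes at [c0], and
   its value is at most [expR (c0 * (u + eta))]. *)
have bound1 N : (I1 N <= (expR (c0 * (u + eta)) * fine (P (hits S0 u)))%:E)%E.
  rewrite /I1 ge0_integral_sum//; last 2 first.
  - by move=> k; exact/measurable_EFinP.
  - by move=> k w _; rewrite lee_fin mulr_ge0.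
  have step (k : 'I_(n N).+1) : (\int[P]_w (M w * (b1 N k w)%:R)%:E =
      \int[P]_w (M0 th (grid R N k) w * (b1 N k w)%:R)%:E)%E.
    rewrite /M -(gn N); apply: (exp_martingale_first_passage r_ hB).
    by rewrite -ltnS ltn_ord.
  under eq_bigr do rewrite step.
  have mfk k : measurable_fun [set: T]
      (fun w => (M0 th (grid R N k) w * (b1 N k w)%:R)%:E).
    apply/measurable_EFinP; apply: measurable_funM.
      by apply: mM; exact: grid_ge0.
    exact: measurable_bool_natr.
  rewrite -ge0_integral_sum//; last first.
    by move=> k w _; rewrite lee_fin mulr_ge0// expR_ge0.
  rewrite EFinM fineK ?fin_num_measure//; last exact: hits_portfolio0_measurable.
  rewrite -[X in (_ <= _ * P X)%E]setIT -(integral_indic P measurableT)//; last first.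
    exact: hits_portfolio0_measurable.
  have mind : measurable_fun [set: T] (fun w => (\1_(hits S0 u) w : R)%:E).
    apply/measurable_EFinP; apply: measurable_indic; exact: hits_portfolio0_measurable.
  rewrite -ge0_integralZl//.
  apply: ge0_le_integral => //.
  - by move=> w _; apply: sume_ge0 => k _; rewrite lee_fin mulr_ge0// expR_ge0.
  - exact: emeasurable_sum.
  - exact: measurable_funeM.
  move=> w _; rewrite sumEFin -EFinM lee_fin.
  have [[k fk]|nf] := pselect (exists k : 'I_(n N).+1, fp u N k w); last first.
    rewrite big1 ?mulr_ge0 ?expR_ge0// => k _; rewrite /b1.
    case: (boolP (fp u N k w)) => [fk|]; last by rewrite mulr0.
    by exfalso; apply: nf; exists k.
  have hw : hits S0 u w.
    rewrite hitsE; exists (grid R N k); split; first exact: grid_ge0.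
    by have /andP[] := fk.
  rewrite indicE mem_set// mulr1.
  apply: (@le_trans _ _ (\sum_(k < (n N).+1) expR (c0 * (u + eta)) * (fp u N k w)%:R)).
    apply: ler_sum => j _; rewrite /b1; case: (fp u N j w) => /=; last by rewrite !mulr0.
    case: (leP (S0 (grid R N j) w) (u + eta)) => [le|_]; last by rewrite mulr0 mulr1 expR_ge0.
    rewrite !mulr1 exp_martingale_scaleE psi_c0 mul0r subr0 ler_expR.
    exact: ler_wpM2l.
  rewrite -mulr_sumr ler_piMr ?expR_ge0//.
  exact: (sum_first_passage_le1 r_ B a).
(* Below [u], half of the exponent [c0 * S0] is bounded by [c0 * u / 2]; the other half is the
   exponential martingale of tilt [c0 / 2], up to its time factor. *)
have bound3 : (I3 <= (expR (c0 * u / 2 + psi2 * h%:R))%:E)%E.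
  rewrite -[leRHS]mule1 -(expectation_exp_martingale r_ hB (fun i => c0 / 2 * a i) (ler0n R h)).
  have mM2 : measurable_fun [set: T]
      (fun w => (M0 (fun i => c0 / 2 * a i) h%:R w)%:E).
    by apply/measurable_EFinP; exact: mM.
  rewrite -ge0_integralZl//; last by move=> w _; rewrite lee_fin expR_ge0.
  apply: ge0_le_integral => //.
  - by move=> w _; rewrite lee_fin mulr_ge0.
  - exact/measurable_EFinP.
  - exact: measurable_funeM.
  move=> w _; rewrite -EFinM lee_fin /b3.
  case: (leP u (S0 h%:R w)) => [_|lt]; first by rewrite mulr0 mulr_ge0// expR_ge0.
  rewrite mulr1 /M -/(M0 _ _ _) !exp_martingale_scaleE -expRD ler_expR psi_c0.
  rewrite -/psi2; have := ler_wpM2l c0_ge0 (ltW lt); lra.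
(* For each path the large overshoot disappears on fine grids, and [M] dominates. *)
have cv2 : I2 @ \oo --> 0%:E.
  rewrite -[X in _ --> X](integral0 P [set: T]).
  apply: (@dominated_cvg _ _ _ P _ measurableT (fun N w => (M w * (b2 N w)%:R)%:E)
    _ (fun w => (M w)%:E)) => //.
  - by move=> N; exact/measurable_EFinP.
  - move=> w _; apply: cvg_near_cst.
    have := @no_grid_overshoot _ (S0^~ w) u eta h.
    move=> /(_ _ _ eta0) ov; apply: filterS (ov _ _).
    + move=> N hN; rewrite (_ : b2 N w = false) ?mulr0//.
      apply/negbTE/existsPn => k; apply/negP => /andP[fk /negP]; apply.
      by apply: hN => //; rewrite -ltnS ltn_ord.
    + exact: (portfolio0_path_continuous hB).
    + by rewrite /S0 portfolio_centered0.
  - move=> N w _; rewrite lee_fin ger0_norm ?mulr_ge0//.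
    by rewrite ler_piMr//; case: (b2 N w).
have [N hN] : exists N, (I2 N < eps%:E)%E.
  have /fine_cvgP[fin2 fcv2] := cv2.
  have [N [fN lN]] := filter_ex (filterI fin2 (cvgr_lt _ fcv2 _ eps0)).
  by exists N; rewrite -(fineK fN) lte_fin.
rewrite -lee_fin !EFinD (le_trans (split3 N))// leeD//.
by rewrite leeD// ltW.
Qed.


Context (psi_half : laplace_exponent Sigma r_ (fun i => c0 / 2 * a i) < 0).

Lemma P_hits_fin u : (fine (P (hits S u)))%:E = P (hits S u).
Proof. by rewrite fineK// fin_num_measure//; exact: hits_portfolio_measurable. Qed.

Lemma ruin_lower_bound u : 0 < u -> 1 <= expR (c0 * u) * fine (P (hits S u)).
Proof.
move=> u0; rewrite (P_hits_centered r_ hB); set p := fine _.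
have p0 : 0 <= p by exact: fine_ge0.
have key eta : 0 < eta -> 1 <= expR (c0 * (u + eta)) * p.
  move=> eta0; apply/ler_addgt0Pr => e e0.
  pose psi2 := laplace_exponent Sigma r_ (fun i => c0 / 2 * a i).
  (* A horizon late enough for the last term of the bound to fall below [e / 2]; this is where
     negativity of [psi2] enters. *)
  pose h := (Num.truncn ((c0 * u / 2 - ln (e / 2)) / - psi2)).+1.
  have e2 : 0 < e / 2 by exact: divr_gt0.
  have := ruin_lower_bound_horizon h u0 eta0 e2; rewrite -/psi2 -/p.
  suff : expR (c0 * u / 2 + psi2 * h%:R) <= e / 2 by lra.
  rewrite -[leRHS]lnK ?posrE// ler_expR.
  have : (c0 * u / 2 - ln (e / 2)) / - psi2 < h%:R by exact: truncnS_gt.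
  rewrite ltr_pdivrMr ?oppr_gt0//; lra.
apply/ler_addgt0Pr => e e0.
have c1 : 0 < c0 + 1 by rewrite ltr_wpDl.
(* An overshoot [eta] with [c0 * eta <= e]; adding 1 keeps the denominator positive even for
   [c0 = 0]. *)
have := key (e / (c0 + 1)) (divr_gt0 e0 c1).
rewrite mulrDr expRD => h.
have ce : c0 * (e / (c0 + 1)) <= e.
  rewrite mulrA ler_pdivrMr// [c0 * e]mulrC ler_pM2l// lerDl//.
set z := c0 * (e / (c0 + 1)) in h ce.
have h2 := expR_ge1Dx (- z).
have h3 : expR (- z) <= expR (c0 * u) * p.
  rewrite -(ler_pM2r (expR_gt0 z)) -expRD addNr expR0; apply: le_trans h _.
  by rewrite le_eqVlt; apply/orP; left; apply/eqP; ring.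
lra.
Qed.

Lemma P_hits u : 0 < u -> P (hits S u) = (expR (- c0 * u))%:E.
Proof.
move=> u0; apply/eqP; rewrite eq_le; apply/andP; split.
  rewrite -P_hits_fin lee_fin -(ler_pM2l (expR_gt0 (c0 * u))) -expRD mulNr subrr expR0.
  rewrite -lee_fin (le_trans _ (exp_martingale_hits_le1 r_ hB a (fun i => c0 * a i) u))//.
  rewrite EFinM P_hits_fin -[X in (_ * P X <= _)%E]setIT -(integral_cst P) ?setIT//; last first.
    exact: hits_portfolio_measurable.
  apply: ge0_le_integral => //.
  - exact: hits_portfolio_measurable.
  - by move=> w _; rewrite lee_fin expR_ge0.
  - apply/measurable_EFinP.
    apply: (@measurable_stopped _ _ _ S
      (exp_martingale Sigma r_ B (fun i => c0 * a i))).
    + by move=> t t0; exact: (portfolio_measurable _ hB).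
    + by move=> t t0; exact: (exp_martingale_measurable _ hB).
    + by move=> w; exact: (portfolio_path_continuous hB).
    + by move=> w; exact: (exp_martingale_path_continuous hB).
  - move=> w hw; rewrite lee_fin /exp_martingale portfolio_scale psi_c0 mul0r subr0.
    rewrite ler_expR; apply: ler_wpM2l => //.
    rewrite hitting_timeE//; move: hw; rewrite hitsE => hw.
    by have [] := dyadic_time_cvg (portfolio_path_continuous (r_ := r_) hB (a := a) (w := w)) hw.
rewrite -P_hits_fin lee_fin -(ler_pM2l (expR_gt0 (c0 * u))) -expRD mulNr subrr expR0.
exact: ruin_lower_bound.
Qed.

(** A supremum equal to [u] need not be attained, so this event can be larger than [hits S u]; it
    allows the near-passages to occur at unbounded times. *)
Lemma path_sup_levelE u : [set w | (u%:E <= path_sup S w)%E] =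
  \bigcap_m \bigcup_N \bigcup_k [set w | lower_level u m <= S (grid R N k) w].
Proof.
apply/seteqP; split => w /=.
  move=> us m _.
  have : ((lower_level u m)%:E < path_sup S w)%E.
    by apply: lt_le_trans us; rewrite lte_fin lower_level_lt.
  move=> /ereal_sup_gt[_ [t /= t0 <-]]; rewrite lte_fin => lt.
  have [q [N [k [-> h]]] _] := dyadic_hit_near
    (portfolio_path_continuous (r_ := r_) hB (a := a) (w := w)) t0 (lexx _) lt ltr01.
  by exists N => //; exists k.
move=> h; apply/lee_addgt0Pr => e e0.
have [m _ /= hm] := near_infty_natSinv_lt (PosNum e0).
have [N _ [k _ /= hk]] := h m I.
apply: (@le_trans _ _ ((S (grid R N k) w + e)%:E)).
  rewrite lee_fin; move: hk; rewrite /lower_level lerBlDr => /le_trans; apply.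
  by rewrite lerD2l ltW//; exact: (hm m (leqnn m)).
rewrite EFinD leeD2r//; apply: ereal_sup_ubound.
by exists (grid R N k) => //=; exact: grid_ge0.
Qed.

Lemma measurable_path_sup_level u : measurable [set w | (u%:E <= path_sup S w)%E].
Proof.
rewrite path_sup_levelE; apply: bigcapT_measurable => m.
apply: bigcupT_measurable => N; apply: bigcupT_measurable => k.
by apply: measurable_level_ge; apply: (portfolio_measurable _ hB); exact: grid_ge0.
Qed.

(** With [P_path_sup_le] this encloses the event between ruin at [u] and ruin at any [v < u];
    continuity of the exponential then closes the gap. *)
Lemma P_path_sup_ge u : 0 < u ->
  ((expR (- c0 * u))%:E <= P [set w | (u%:E <= path_sup S w)%E])%E.
Proof.
move=> u0; rewrite -P_hits//; apply: le_measure; rewrite ?inE.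
- exact: hits_portfolio_measurable.
- exact: measurable_path_sup_level.
- rewrite hitsE => w [t [t0 ut]] /=.
  apply: (@le_trans _ _ (S t w)%:E); first by rewrite lee_fin.
  by apply: ereal_sup_ubound; exists t.
Qed.

Lemma P_path_sup_le u v : 0 < v -> v < u ->
  (P [set w | (u%:E <= path_sup S w)%E] <= (expR (- c0 * v))%:E)%E.
Proof.
move=> v0 vu; rewrite -P_hits//; apply: le_measure; rewrite ?inE.
- exact: measurable_path_sup_level.
- exact: hits_portfolio_measurable.
- rewrite hitsE => w /= us.
  have : (v%:E < path_sup S w)%E by apply: lt_le_trans us; rewrite lte_fin.
  move=> /ereal_sup_gt[_ [t /= t0 <-]]; rewrite lte_fin => lt.
  by exists t; split => //; exact: ltW.
Qed.

Lemma P_path_sup u : 0 < u ->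
  P [set w | (u%:E <= path_sup S w)%E] = (expR (- c0 * u))%:E.
Proof.
move=> u0; apply/eqP; rewrite eq_le P_path_sup_ge// andbT.
rewrite -[P _]fineK ?fin_num_measure//; last exact: measurable_path_sup_level.
rewrite lee_fin; pose v (n : nat) := u - u / 2 * n.+1%:R^-1.
have v0 n : 0 < v n.
  rewrite subr_gt0 (@le_lt_trans _ _ (u / 2))//; last by lra.
  apply: ler_piMr; first by rewrite ltW// divr_gt0.
  by rewrite invf_le1 ?ltr0n// ler1n.
have vu n : v n < u by rewrite ltrBlDl ltrDr mulr_gt0 ?divr_gt0.
have vcvg : v @ \oo --> u.
  rewrite -[X in _ --> X]subr0 -[X in _ - X](mulr0 (u / 2)).
  by apply: cvgB; [exact: cvg_cst|apply: cvgM; [exact: cvg_cst|exact: cvg_harmonic]].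
have ecvg : (fun n => expR (- c0 * v n)) @ \oo --> expR (- c0 * u).
  apply: (@continuous_cvg _ _ _ _ _ _ (@expR R)); first exact: continuous_expR.
  by apply: cvgM => //; exact: cvg_cst.
apply: (cvgr_to_ge ecvg); apply: nearW => n; rewrite -lee_fin fineK.
  exact: P_path_sup_le.
by rewrite fin_num_measure//; exact: measurable_path_sup_level.
Qed.

Lemma VaR_portfolio alpha : 0 < alpha -> alpha < 1 -> 0 < c0 ->
  VaR P alpha S = (- ln alpha / c0)%:E.
Proof.
move=> al0 al1 c0_gt0; set u := - ln alpha / c0.
have lnal : ln alpha < 0 by apply: ln_lt0; rewrite al0.
have u0 : 0 < u by rewrite divr_gt0// oppr_gt0.
have alE : alpha = expR (- c0 * u).
  by rewrite /u mulNr mulrCA divff ?gt_eqF// mulr1 opprK lnK// posrE.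
apply/eqP; rewrite eq_le; apply/andP; split.
  apply: ereal_inf_lbound; exists u => //=; split; first exact: ltW.
  by rewrite alE P_path_sup.
apply: le_ereal_inf_tmp => _ [v /= [v0 hv] <-]; rewrite lee_fin leNgt; apply/negP => vu.
(* The candidate [v] may be 0, while [P_path_sup_ge] needs a positive level; the midpoint is
   positive and still below [u]. *)
pose v' := (v + u) / 2.
have v'0 : 0 < v' by rewrite divr_gt0// ltr_wpDl.
have vv' : v < v' by rewrite /v'; lra.
have v'u : v' < u by rewrite /v'; lra.
have := P_path_sup_ge v'0.
have : (P [set w | (v'%:E <= path_sup S w)%E] <= alpha%:E)%E.
  apply: le_trans hv; apply: le_measure; rewrite ?inE.
  - exact: measurable_path_sup_level.
  - exact: measurable_path_sup_level.
  - by move=> w /=; apply: le_trans; rewrite lee_fin ltW.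
move=> h1 h2; have := le_trans h2 h1; rewrite lee_fin alE ler_expR !mulNr lerN2.
by rewrite ler_pM2l// leNgt v'u.
Qed.

End ruin_probability.

(** * Allocation at the time of ruin *)

(** A first-order condition without derivatives: testing at [e = x / k] with [k > y] leaves a square
    that is at most 0. *)
Lemma linear_le_quadratic_eq0 (R : realFieldType) (x y : R) :
  (forall e, e * x <= e ^+ 2 * y) -> x = 0.
Proof.
move=> h; pose k := `|y| + 1.
have k0 : 0 < k by rewrite /k ltr_wpDl.
have yk : y < k by rewrite /k (le_lt_trans (ler_norm y))// ltrDl.
have [z xE] : exists z, x = z * k by exists (x / k); rewrite divfK// gt_eqF.
have := h z; rewrite {}xE => hz.
have : z ^+ 2 * (k - y) <= 0 by lra.
rewrite pmulr_lle0 ?subr_gt0// => z2.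
have /eqP : z ^+ 2 == 0 by rewrite eq_le z2 sqr_ge0.
by move=> /eqP; rewrite sqrf_eq0 => /eqP ->; rewrite mul0r.
Qed.

Section allocation.
Context (R : realType) (disp : measure_display) (T : measurableType disp).
Context (P : probability T R) (d : nat) (Sigma : 'M[R]_d) (r_ : 'I_d -> R).
Context (B : 'I_d -> R -> T -> R) (hB : brownian_motion P Sigma B).

(** Symmetry of [Sigma] comes from its being the covariance matrix of the increments over
    [[0, 1]]. *)
Lemma brownian_cov_sym i j : Sigma i j = Sigma j i.
Proof.
case: hB => _ _ _ _ /(_ 0 1 (lexx 0) ler01)[_ _ cov].
apply: EFin_inj; have := cov i j; have := cov j i.
by rewrite !mxE subr0 !mul1r => <- <-; rewrite covarianceC.
Qed.

Lemma qform_perturb (a : 'I_d -> R) i (e : R) :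
  qform Sigma (fun j => a j + (if j == i then e else 0))
              (fun j => a j + (if j == i then e else 0)) =
  qform Sigma a a + 2 * e * (\sum_j a j * Sigma i j) + e ^+ 2 * Sigma i i.
Proof.
pose dl (j : 'I_d) : R := if j == i then e else 0.
have dsum (f : 'I_d -> R) : \sum_j dl j * f j = e * f i.
  rewrite (bigD1 i)//= /dl eqxx big1 ?addr0// => j /negbTE ->.
  by rewrite mul0r.
transitivity (\sum_j \sum_k a j * a k * Sigma j k +
   \sum_j a j * (\sum_k dl k * Sigma j k) +
   \sum_j dl j * (\sum_k a k * Sigma j k) +
   \sum_j dl j * (\sum_k dl k * Sigma j k)).
  rewrite -!big_split/=; apply: eq_bigr => j _; rewrite !mulr_sumr -!big_split/=.
  by apply: eq_bigr => k _; rewrite -/(dl j) -/(dl k); ring.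
have mid : \sum_j a j * (\sum_k dl k * Sigma j k) = e * \sum_j a j * Sigma i j.
  rewrite mulr_sumr; apply: eq_bigr => j _.
  by rewrite (dsum (Sigma j)) (brownian_cov_sym j i); ring.
rewrite mid (dsum (fun j => \sum_k a k * Sigma j k)).
rewrite (dsum (fun j => \sum_k dl k * Sigma j k)) (dsum (Sigma i)) /qform; ring.
Qed.

Lemma drift_perturb (a : 'I_d -> R) i (e : R) :
  drift r_ (fun j => a j + (if j == i then e else 0)) = drift r_ a + e * r_ i.
Proof.
rewrite /drift; under eq_bigr do rewrite mulrDl.
rewrite big_split/=; congr (_ + _).
rewrite (bigD1 i)//= eqxx big1 ?addr0// => j /negbTE ->.
by rewrite mul0r.
Qed.

Lemma portfolio_perturb (a : 'I_d -> R) i (e : R) t w :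
  portfolio r_ B (fun j => a j + (if j == i then e else 0)) t w =
  portfolio r_ B a t w + e * (r_ i * t + B i t w).
Proof.
rewrite /portfolio; under eq_bigr do rewrite mulrDl.
rewrite big_split/=; congr (_ + _).
rewrite (bigD1 i)//= eqxx big1 ?addr0// => j /negbTE ->.
by rewrite mul0r.
Qed.

Lemma VaR_portfolioE (a : 'I_d -> R) alpha : 0 < alpha -> alpha < 1 ->
  0 < qform Sigma a a -> drift r_ a < 0 ->
  VaR P alpha (portfolio r_ B a) =
  (qform Sigma a a / (2 * drift r_ a) * ln alpha)%:E.
Proof.
move=> al0 al1 q0 m0; set q := qform _ _ _ in q0 *; set m := drift _ _ in m0 *.
(* The nonzero root of [c * m + c ^+ 2 * q / 2]; at its half the value is [- m ^+ 2 / (2 * q)]. *)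
pose c0 := - 2 * m / q.
have c0_gt0 : 0 < c0 by rewrite divr_gt0// mulNr oppr_gt0 pmulr_rlt0.
have qn0 : q != 0 by rewrite gt_eqF.
have mn0 : m != 0 by rewrite lt_eqF.
have psi0 : laplace_exponent Sigma r_ (fun i => c0 * a i) = 0.
  by rewrite laplace_exponent_scale -/q -/m /c0; field.
have psih : laplace_exponent Sigma r_ (fun i => c0 / 2 * a i) < 0.
  rewrite laplace_exponent_scale -/q -/m (_ : _ + _ = - (m ^+ 2 / q / 2)); last first.
    by rewrite /c0; field.
  by rewrite oppr_lt0 !divr_gt0// exprn_even_gt0.
rewrite (VaR_portfolio hB (ltW c0_gt0) psi0 psih)//; congr EFin.
by rewrite /c0; field; rewrite qn0 mn0.
Qed.

Let one : 'I_d -> R := fun=> 1.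
Let S (t : R) (w : T) := portfolio r_ B one t w.
Let s2 := qform Sigma one one.
Let r := drift r_ one.
Let c0 := - 2 * r / s2.
Context (s2_gt0 : 0 < s2) (r_lt0 : r < 0).
Context (u : R) (u_gt0 : 0 < u).
Let D := hits S u.
Let tau w := fine (hitting_time S u w).
Let Si i t w := r_ i * t + B i t w.

Lemma c0_gt0 : 0 < c0.
Proof. by rewrite divr_gt0// mulNr oppr_gt0 pmulr_rlt0. Qed.

Let s2n0 : s2 != 0. Proof. by rewrite gt_eqF. Qed.
Let rn0 : r != 0. Proof. by rewrite lt_eqF. Qed.

Lemma psi_c0_eq0 : laplace_exponent Sigma r_ (fun i => c0 * one i) = 0.
Proof. by rewrite laplace_exponent_scale -/s2 -/r /c0; field. Qed.

Lemma psi_half_lt0 : laplace_exponent Sigma r_ (fun i => c0 / 2 * one i) < 0.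
Proof.
rewrite laplace_exponent_scale -/s2 -/r (_ : _ + _ = - (r ^+ 2 / s2 / 2)); last first.
  by rewrite /c0; field.
by rewrite oppr_lt0 !divr_gt0// exprn_even_gt0.
Qed.

Lemma P_ruin : P D = (expR (- c0 * u))%:E.
Proof. exact: (P_hits hB (ltW c0_gt0) psi_c0_eq0 psi_half_lt0). Qed.

Lemma ruin_measurable : measurable D.
Proof. exact: (hits_portfolio_measurable _ hB). Qed.

Let mS t : 0 <= t -> measurable_fun [set: T] (S t).
Proof. exact: (portfolio_measurable _ hB). Qed.

Let cS w : path_continuous (S^~ w).
Proof. exact: (portfolio_path_continuous hB). Qed.

Lemma ruin_time_ge0 w : D w -> 0 <= tau w /\ u <= S (tau w) w.
Proof.
move=> Dw; rewrite /tau hitting_timeE//; move: Dw; rewrite /D hitsE => h.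
by have [_ ? ?] := dyadic_time_cvg (@cS w) h.
Qed.

Lemma measurable_at_ruin i : measurable_fun D (fun w => Si i (tau w) w).
Proof.
apply: (@measurable_stopped _ _ _ S (Si i)) => //.
- move=> t t0; apply: measurable_funD => //; exact: (brownian_measurable hB).
- by move=> w; exact: (asset_path_continuous hB).
Qed.

Lemma measurable_ruin_time : measurable_fun D tau.
Proof.
apply: (@measurable_stopped _ _ _ S (fun t _ => t)) => //.
by move=> w; exact: path_continuous_id.
Qed.

Lemma exp_at_ruin_le1 (c : R) i (e : R) :
  (\int[P]_(w in D) (expR (c * S (tau w) w + e * Si i (tau w) w -
     laplace_exponent Sigma r_
       (fun j => c * one j + (if j == i then e else 0)) * tau w))%:E <= 1)%E.
Proof.
have := exp_martingale_hits_le1 r_ hB one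
  (fun j => c * one j + (if j == i then e else 0)) u.
under eq_integral do
  rewrite /exp_martingale portfolio_perturb portfolio_scale -/(S _ _) -/(Si _ _ _).
by [].
Qed.

Lemma measurable_exp_at_ruin (c e k : R) i : measurable_fun D
  (fun w => (expR (c * S (tau w) w + e * Si i (tau w) w - k * tau w))%:E).
Proof.
apply/measurable_EFinP; apply: measurableT_comp => //.
have mSt : measurable_fun D (fun w => S (tau w) w).
  by apply: (@measurable_stopped _ _ _ S S).
apply: measurable_funB.
  apply: measurable_funD; apply: measurable_funM => //; exact: measurable_at_ruin.
by apply: measurable_funM => //; exact: measurable_ruin_time.
Qed.

Lemma psi_perturb (c : R) i (e : R) :
  laplace_exponent Sigma r_ (fun j => c * one j + (if j == i then e else 0)) =
  laplace_exponent Sigma r_ (fun j => c * one j) +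
    e * (r_ i + c * \sum_j Sigma i j) + e ^+ 2 * Sigma i i / 2.
Proof.
rewrite /laplace_exponent qform_perturb drift_perturb.
have -> : \sum_j c * one j * Sigma i j = c * \sum_j Sigma i j.
  by rewrite mulr_sumr; apply: eq_bigr => j _; rewrite /one mulr1.
by field.
Qed.

(** A small extra tilt of asset [i] uses up at most half of the negative exponent at [c0 / 2]; the
    other half remains as a margin for integrability. *)
Lemma small_tilt i : exists2 e : R, 0 < e & forall e', `|e'| <= e ->
  laplace_exponent Sigma r_ (fun j => c0 / 2 * one j + (if j == i then e' else 0)) <=
  laplace_exponent Sigma r_ (fun j => c0 / 2 * one j) / 2.
Proof.
set psi := laplace_exponent Sigma r_ (fun j => c0 / 2 * one j).
have psi0 : psi < 0 := psi_half_lt0.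
pose K := `|r_ i + c0 / 2 * \sum_j Sigma i j| + `|Sigma i i / 2| + 1.
have K0 : 0 < K by rewrite /K ltr_wpDl// addr_ge0.
(* The cap 1 bounds [e' ^+ 2] by [|e'|], so that the whole perturbation is linear in [|e'|] with
   constant at most [K]. *)
pose e := Num.min 1 (- psi / 2 / K).
have e0 : 0 < e by rewrite lt_min ltr01/= !divr_gt0// oppr_gt0.
exists e => // e' he; rewrite psi_perturb -/psi.
set A := r_ i + _ in K K0 e e0 he *; set C := Sigma i i / 2 in K K0 e e0 he *.
have he1 : `|e'| <= 1 by rewrite (le_trans he)// /e ge_min lexx.
have heK : `|e'| * K <= - psi / 2.
  by rewrite -ler_pdivlMr// (le_trans he)// /e ge_min lexx orbT.
have h1 : e' * A <= `|e'| * `|A| by rewrite -normrM ler_norm.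
have h2 : e' ^+ 2 * Sigma i i / 2 <= `|e'| * `|C|.
  rewrite -mulrA -/C (le_trans (ler_norm _))// normrM ler_wpM2r// normrX expr2.
  by rewrite ler_piMl.
have h3 : `|e'| * K = `|e'| * `|A| + `|e'| * `|C| + `|e'| by rewrite /K; ring.
have := normr_ge0 e'; lra.
Qed.

(** The factor [expR (c0 / 2 * S (tau w) w)] is at least 1 on ruin, as [S] is then at least [u > 0].
    Dropping it leaves an integrand below the stopped exponential martingale, whose integral is at
    most 1. *)
Lemma integrable_exp_tilt i (e : R) :
  laplace_exponent Sigma r_ (fun j => c0 / 2 * one j + (if j == i then e else 0)) <=
  laplace_exponent Sigma r_ (fun j => c0 / 2 * one j) / 2 ->
  P.-integrable D (fun w => (expR (e * Si i (tau w) w -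
    laplace_exponent Sigma r_ (fun j => c0 / 2 * one j) / 2 * tau w))%:E).
Proof.
set psi := laplace_exponent Sigma r_ (fun j => c0 / 2 * one j) => he.
have mD := ruin_measurable.
apply/integrableP; split.
  have := measurable_exp_at_ruin 0 e (psi / 2) i.
  by under eq_fun do rewrite mul0r add0r.
apply: (@le_lt_trans _ _ 1%E); last exact: ltry.
apply: le_trans (exp_at_ruin_le1 (c0 / 2) i e).
apply: ge0_le_integral => //.
- apply: measurableT_comp => //; have := measurable_exp_at_ruin 0 e (psi / 2) i.
  by under eq_fun do rewrite mul0r add0r.
- exact: measurable_exp_at_ruin.
- move=> w Dw; rewrite gee0_abs ?lee_fin ?expR_ge0// ler_expR.
  have [t0 ut] := ruin_time_ge0 Dw.
  have := ler_wpM2r t0 he.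
  have : 0 <= c0 / 2 * S (tau w) w.
    apply: mulr_ge0; last exact: le_trans (ltW u_gt0) ut.
    by apply: ltW; rewrite divr_gt0// c0_gt0.
  lra.
Qed.

(** Tilts [e] and [- e] together dominate [|e * S_i|]; the time term in the exponent is nonnegative
    and only enlarges the bound. *)
Lemma integrable_at_ruin i : P.-integrable D (fun w => (Si i (tau w) w)%:E).
Proof.
have mD := ruin_measurable.
have [e e0 he] := small_tilt i.
have e1 : `|e| <= e by rewrite ger0_norm// ltW.
have e2 : `|- e| <= e by rewrite normrN.
have := @integrableZl _ _ _ P D mD e^-1 _ (integrableD mD
  (integrable_exp_tilt (he e e1)) (integrable_exp_tilt (he (- e) e2))).
apply: le_integrable => //; first by apply/measurable_EFinP; exact: measurable_at_ruin.
move=> w Dw /=; rewrite lee_fin [leRHS]ger0_norm; last first.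
  apply: mulr_ge0; first by rewrite invr_ge0 ltW.
  by apply: addr_ge0; exact: expR_ge0.
rewrite ler_pdivlMl//; have [t0 ut] := ruin_time_ge0 Dw.
rewrite -{1}(gtr0_norm e0) -normrM; apply: le_trans (normr_le_expRD _) _.
rewrite -[X in expR X + _]addr0 -[X in _ + expR X]addr0.
have h : 0 <= - (laplace_exponent Sigma r_ (fun j => c0 / 2 * one j) / 2 * tau w).
  by rewrite oppr_ge0 mulr_le0_ge0// pmulr_lle0// ltW// psi_half_lt0.
by rewrite lerD// ler_expR ?mulNr lerD2l.
Qed.

Lemma integrable_ruin_time (i : 'I_d) : P.-integrable D (fun w => (tau w)%:E).
Proof.
have mD := ruin_measurable.
set psi := laplace_exponent Sigma r_ (fun j => c0 / 2 * one j).
have psi0 : psi < 0 := psi_half_lt0.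
have k0 : 0 < - (psi / 2) by rewrite oppr_gt0 pmulr_llt0.
have [e e0 he] := small_tilt i.
have h0 : `|0 : R| <= e by rewrite normr0 ltW.
have := @integrableZl _ _ _ P D mD (- (psi / 2))^-1 _ (integrable_exp_tilt (he 0 h0)).
apply: le_integrable => //; first by apply/measurable_EFinP; exact: measurable_ruin_time.
move=> w Dw /=; have [t0 _] := ruin_time_ge0 Dw.
rewrite lee_fin ger0_norm// ger0_norm; last first.
  by rewrite mulr_ge0 ?expR_ge0// invr_ge0 ltW.
rewrite ler_pdivlMl// mul0r add0r -/psi.
have := expR_ge1Dx (- (psi / 2 * tau w)); lra.
Qed.

Let p := fine (P D).
Let M := fine (\int[P]_(w in D) (tau w)%:E).
Let m i := fine (\int[P]_(w in D) (Si i (tau w) w)%:E).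

Lemma ruin_probE : P D = p%:E.
Proof. by rewrite fineK// fin_num_measure//; exact: ruin_measurable. Qed.

Lemma ruin_prob_gt0 : 0 < p.
Proof. by rewrite /p P_ruin expR_gt0. Qed.

Lemma mean_ruin_timeE (i : 'I_d) : (\int[P]_(w in D) (tau w)%:E = M%:E)%E.
Proof.
rewrite fineK//; apply: integrable_fin_num (integrable_ruin_time i).
exact: ruin_measurable.
Qed.

Lemma mean_at_ruinE i : (\int[P]_(w in D) (Si i (tau w) w)%:E = (m i)%:E)%E.
Proof.
rewrite fineK//; apply: integrable_fin_num (integrable_at_ruin i).
exact: ruin_measurable.
Qed.

(* [exp_at_ruin_le1] is an equality at the tilt [c0]; since [1 + x <= expR x],
   perturbing the tilt of asset [i] by [e] in both directions pins down the
   first-order term in [e]. *)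
Lemma mean_at_ruin i : m i = (r_ i + c0 * \sum_j Sigma i j) * M.
Proof.
have mD := ruin_measurable.
apply/eqP; rewrite -subr_eq0; apply/eqP.
apply: (@linear_le_quadratic_eq0 _ _ (Sigma i i / 2 * M)) => e.
set psi := laplace_exponent Sigma r_ (fun j => c0 * one j + (if j == i then e else 0)).
have psiE : psi = e * (r_ i + c0 * \sum_j Sigma i j) + e ^+ 2 * Sigma i i / 2.
  by rewrite /psi psi_perturb psi_c0_eq0 add0r.
suff : e * m i - psi * M <= 0 by rewrite psiE; lra.
have iS := integrable_at_ruin i; have it := integrable_ruin_time i.
have ic : P.-integrable D (fun=> (expR (c0 * u))%:E).
  exact: finite_measure_integrable_cst.
(* The affine minorant of the exponential, with [S (tau w) w] replaced by its lower bound [u]; its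
   integral is explicit in [p], [m i] and [M]. *)
pose F w := (expR (c0 * u) * (1 + (e * Si i (tau w) w - psi * tau w)))%:E.
have FE : F = (fun w => (expR (c0 * u))%:E +
    ((expR (c0 * u) * e)%:E * (Si i (tau w) w)%:E +
     (- (expR (c0 * u) * psi))%:E * (tau w)%:E))%E.
  by apply/funext => w; rewrite /F -!EFinM -!EFinD; congr EFin; ring.
have iF1 := @integrableZl _ _ _ P D mD (expR (c0 * u) * e) _ iS.
have iF2 := @integrableZl _ _ _ P D mD (- (expR (c0 * u) * psi)) _ it.
have iF12 := integrableD mD iF1 iF2.
have iF : P.-integrable D F by rewrite FE; have := integrableD mD ic iF12.
have intF : (\int[P]_(w in D) F w =
    (expR (c0 * u) * (p + (e * m i - psi * M)))%:E)%E.
  rewrite FE (integralD mD ic iF12) (integralD mD iF1 iF2).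
  rewrite (integralZl mD iS) (integralZl mD it) mean_at_ruinE (mean_ruin_timeE i).
  rewrite (_ : \int[P]_(_ in D) _ = (expR (c0 * u) * p)%:E)%E; last first.
    by rewrite integral_cst//= EFinM; congr (_ * _)%E; exact: ruin_probE.
  rewrite -!EFinM -!EFinD; congr EFin; ring.
have : (\int[P]_(w in D) F w <= 1)%E.
  apply: le_trans (exp_at_ruin_le1 c0 i e); rewrite -/psi.
  have iexp : P.-integrable D (fun w => (expR (c0 * S (tau w) w +
      e * Si i (tau w) w - psi * tau w))%:E).
    apply/integrableP; split; first exact: measurable_exp_at_ruin.
    under eq_integral do rewrite gee0_abs ?lee_fin ?expR_ge0//.
    by apply: le_lt_trans (exp_at_ruin_le1 c0 i e) _; exact: ltry.
  apply: le_integral => // w /[!inE] Dw; have [t0 ut] := ruin_time_ge0 Dw.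
  rewrite lee_fin -addrA expRD.
  apply: (@le_trans _ _ (expR (c0 * u) * expR (e * Si i (tau w) w - psi * tau w))).
    by rewrite ler_pM2l ?expR_gt0// expR_ge1Dx.
  by rewrite ler_pM2r ?expR_gt0// ler_expR ler_pM2l// c0_gt0.
(* The constant term is exactly 1 by the formula for the ruin probability, so the bound 1 leaves
   only the variation, which must be at most 0. *)
rewrite intF lee_fin mulrDr (_ : expR (c0 * u) * p = 1).
  by rewrite -lerBrDl subrr pmulr_rle0// expR_gt0.
by rewrite /p P_ruin/= -expRD mulNr subrr expR0.
Qed.

Lemma aggregate_at_ruin_ae : {ae P, forall w, D w -> S (tau w) w = u}.
Proof.
apply: filterS (ae_centered hB) => w B0 Dw; rewrite /tau hitting_timeE//.
apply: (@passage_value _ (S^~ w) u) => //; last by move: Dw; rewrite /D hitsE.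
rewrite /S /portfolio big1// => i _.
by rewrite mulr0 B0 addr0 mulr0.
Qed.

Lemma mean_aggregate_at_ruin : (\int[P]_(w in D) (S (tau w) w)%:E = (u * p)%:E)%E.
Proof.
have mD := ruin_measurable.
rewrite EFinM -ruin_probE -(integral_cst P mD); apply: ae_eq_integral => //.
- by apply/measurable_EFinP; apply: (@measurable_stopped _ _ _ S S).
- by apply: filterS aggregate_at_ruin_ae => w h Dw; rewrite h.
Qed.

(** Summing [mean_at_ruin] over the assets gives [u * p = (r + c0 * s2) * M], and
    [c0 * s2 = - 2 * r]. *)
Lemma mean_ruin_time (i : 'I_d) : M = u * p / - r.
Proof.
have mD := ruin_measurable.
have : \sum_j m j = u * p.
  apply: EFin_inj; rewrite -mean_aggregate_at_ruin -sumEFin.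
  under eq_bigr do rewrite -mean_at_ruinE.
  rewrite -integral_sum//; last by move=> j; exact: integrable_at_ruin.
  apply: eq_integral => w _; rewrite sumEFin; congr EFin.
  by apply: eq_bigr => j _; rewrite /one mul1r.
under eq_bigr do rewrite mean_at_ruin.
rewrite -mulr_suml big_split/= -mulr_sumr.
have -> : \sum_(j < d) r_ j = r.
  by rewrite /r /drift; apply: eq_bigr => j _; rewrite /one mul1r.
have -> : \sum_(j < d) \sum_k Sigma j k = s2.
  rewrite /s2 /qform; apply: eq_bigr => j _; apply: eq_bigr => k _.
  by rewrite /one !mul1r.
move=> <-; rewrite /c0; field; by rewrite s2n0 rn0.
Qed.

Lemma mean_asset_at_ruin i :
  m i = u * p * (2 * (\sum_j Sigma i j) / s2 - r_ i / r).
Proof.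
rewrite mean_at_ruin (mean_ruin_time i) /c0; field; by rewrite s2n0 rn0.
Qed.

End allocation.

(** * Gradient allocation *)

Lemma cvg_quadratic0 (R : realType) (a b c : R) :
  (fun h : R => a + h * (b + h * c)) @ (0 : R) --> a.
Proof.
rewrite -[X in _ --> X]addr0 -[X in _ + X](mul0r (b + 0 * c)).
apply: cvgD; first exact: cvg_cst.
apply: cvgM; first exact: cvg_id.
apply: cvgD; first exact: cvg_cst.
by apply: cvgM; [exact: cvg_id|exact: cvg_cst].
Qed.

Section gradient.
Context (R : realType) (disp : measure_display) (T : measurableType disp).
Context (P : probability T R) (d : nat) (Sigma : 'M[R]_d) (r_ : 'I_d -> R).
Context (B : 'I_d -> R -> T -> R) (hB : brownian_motion P Sigma B).
Context (alpha : R) (halpha0 : 0 < alpha) (halpha1 : alpha < 1).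

Let S : 'I_d -> R -> T -> R := fun i t w => r_ i * t + B i t w.
Let one : 'I_d -> R := fun=> 1.
Let r : R := \sum_(i < d) r_ i.
Let s2 : R := \sum_(i < d) \sum_(j < d) Sigma i j.
Context (s2_gt0 : 0 < s2) (r_lt0 : r < 0).
Let u := s2 / (2 * r) * ln alpha.

Let s2n0 : s2 != 0. Proof. by rewrite gt_eqF. Qed.
Let rn0 : r != 0. Proof. by rewrite lt_eqF. Qed.

Lemma aggregateE : aggregate S = portfolio r_ B one.
Proof.
apply/funext => t; apply/funext => w.
by apply: eq_bigr => i _; rewrite mul1r.
Qed.

Lemma reweightedE i x : reweighted S i x =
  portfolio r_ B (fun j => one j + (if j == i then x - 1 else 0)).
Proof.
apply/funext => t; apply/funext => w; rewrite portfolio_perturb.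
have -> : portfolio r_ B one t w = \sum_j S j t w.
  by apply: eq_bigr => j _; rewrite mul1r.
by rewrite (bigD1 i)//= /reweighted /S; ring.
Qed.

Lemma qform_one : qform Sigma one one = s2.
Proof.
by apply: eq_bigr => j _; apply: eq_bigr => k _; rewrite !mul1r.
Qed.

Lemma drift_one : drift r_ one = r.
Proof. by apply: eq_bigr => j _; rewrite mul1r. Qed.

Lemma VaR_aggregate : VaR P alpha (aggregate S) = u%:E.
Proof.
rewrite aggregateE (VaR_portfolioE hB halpha0 halpha1) ?qform_one ?drift_one//.
Qed.

Lemma VaR_level_gt0 : 0 < u.
Proof.
have l0 : ln alpha < 0 by apply: ln_lt0; rewrite halpha0.
by rewrite /u nmulr_lgt0// pmulr_rlt0// invr_lt0 pmulr_rlt0.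
Qed.

Let c i := \sum_(j < d) Sigma i j.

(** The term [h * 0] gives the linear drift the quadratic shape of [cvg_quadratic0]. *)
Lemma VaR_reweighted i h :
  0 < s2 + h * (2 * c i + h * Sigma i i) -> 0 > r + h * (r_ i + h * 0) ->
  VaR P alpha (reweighted S i (h + 1)) =
  ((s2 + h * (2 * c i + h * Sigma i i)) / (2 * (r + h * (r_ i + h * 0))) *
    ln alpha)%:E.
Proof.
move=> q0 m0; rewrite reweightedE addrK.
have qE : qform Sigma (fun j => one j + (if j == i then h else 0))
    (fun j => one j + (if j == i then h else 0)) =
    s2 + h * (2 * c i + h * Sigma i i).
  rewrite (qform_perturb hB) qform_one.
  have -> : \sum_j one j * Sigma i j = c i.
    by apply: eq_bigr => j _; rewrite mul1r.
  by ring.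
have mE : drift r_ (fun j => one j + (if j == i then h else 0)) =
    r + h * (r_ i + h * 0).
  by rewrite drift_perturb drift_one; ring.
by rewrite (VaR_portfolioE hB halpha0 halpha1) ?qE ?mE.
Qed.

Lemma near_reweighted i : \forall h \near (0 : R),
  0 < s2 + h * (2 * c i + h * Sigma i i) /\ 0 > r + h * (r_ i + h * 0).
Proof.
apply: filterI.
- exact: (cvgr_gt _ (@cvg_quadratic0 R s2 (2 * c i) (Sigma i i))).
- exact: (cvgr_lt _ (@cvg_quadratic0 R r (r_ i) 0)).
Qed.

(** The quotient rule at weight 1: the variance has derivative [2 * c i] there and the drift has
    derivative [r_ i]. *)
Let dVaR i := ((2 * c i) * r - s2 * r_ i) / (2 * r * r) * ln alpha.

Lemma cvg_VaR_reweighted i :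
  (fun h : R => h^-1 *: (fine (VaR P alpha (reweighted S i (h *: 1 + 1))) -
     fine (VaR P alpha (reweighted S i 1)))) @ (0 : R)^' --> dVaR i.
Proof.
(* The difference quotient after cancelling [h], which extends continuously to [h = 0]. *)
pose G (h : R) := ((2 * c i + h * Sigma i i) * r - s2 * r_ i) /
  (2 * r * (r + h * (r_ i + h * 0))) * ln alpha.
have cG : G @ (0 : R) --> dVaR i.
  apply: cvgM; last exact: cvg_cst.
  apply: cvgM.
    apply: cvgB; last exact: cvg_cst.
    apply: cvgM; last exact: cvg_cst.
    rewrite -[X in _ --> X]addr0 -[X in _ + X](mul0r (Sigma i i)).
    apply: cvgD; first exact: cvg_cst.
    by apply: cvgM; [exact: cvg_id|exact: cvg_cst].
  apply: cvgV; first by rewrite !mulf_neq0// pnatr_eq0.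
  apply: cvgM; [exact: cvg_cst|exact: cvg_quadratic0].
have cG' : G @ (0 : R)^' --> dVaR i by apply: cvg_trans cG; apply: cvg_app; exact: nbhs_dnbhs.
apply: cvg_trans cG'; apply: near_eq_cvg.
have nz : \forall h \near (0 : R)^', h != 0 by exact: nbhs_dnbhs_neq.
have nq : \forall h \near (0 : R)^', 0 < s2 + h * (2 * c i + h * Sigma i i) /\
    0 > r + h * (r_ i + h * 0) by apply: nbhs_dnbhs; exact: near_reweighted.
apply: filterS (filterI nz nq) => h [h0 [q0 m0]].
have [q0' m0'] := nbhs_singleton (near_reweighted i).
rewrite [h *: 1]mulr1 VaR_reweighted//.
have e01 : reweighted S i 1 = reweighted S i (0 + 1) by rewrite add0r.
rewrite e01 VaR_reweighted//.
rewrite /= /G /GRing.scale/=.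
have m1 : r + h * r_ i != 0 by move: m0; rewrite mulr0 addr0 => /lt_eqF ->.
rewrite !(mul0r, mulr0, addr0); field.
by rewrite m1 rn0 h0.
Qed.

Lemma GVaR_existsP i : GVaR_exists P S alpha i.
Proof.
split; last by apply/cvg_ex; exists (dVaR i); exact: cvg_VaR_reweighted.
have shift : (fun x : R => x - 1) @ (1 : R) --> (0 : R).
  rewrite -[X in _ --> X](subrr 1); apply: cvgB; [exact: cvg_id|exact: cvg_cst].
have near1 : \forall x \near (1 : R), 0 < s2 + (x - 1) * (2 * c i + (x - 1) * Sigma i i) /\
    0 > r + (x - 1) * (r_ i + (x - 1) * 0).
  exact: (shift _ (near_reweighted i)).
apply: filterS near1 => x [q0 m0].
by rewrite -(subrK 1 x) VaR_reweighted.
Qed.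

Lemma GVaR_value i : GVaR P S alpha i = u * (2 * c i / s2 - r_ i / r).
Proof.
transitivity (dVaR i).
  rewrite /GVaR derive1E /derive; apply: cvg_lim => //; exact: cvg_VaR_reweighted.
by rewrite /dVaR /u; field; rewrite s2n0 rn0.
Qed.

Let D := hits (aggregate S) u.
Let p := fine (P D).

Let s2_gt0' : 0 < qform Sigma one one. Proof. by rewrite qform_one. Qed.
Let r_lt0' : drift r_ one < 0. Proof. by rewrite drift_one. Qed.

Lemma prob_hits_gt0 : 0 < p.
Proof.
by rewrite /p /D aggregateE; exact: (ruin_prob_gt0 hB s2_gt0' r_lt0' VaR_level_gt0).
Qed.

Lemma prob_hitsE : P D = p%:E.
Proof. by rewrite /p /D aggregateE; exact: (ruin_probE r_ hB u). Qed.

Lemma integrable_asset i : P.-integrable D (EFin \o at_ruin S u (S i)).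
Proof.
rewrite /D /at_ruin aggregateE.
exact: (integrable_at_ruin hB s2_gt0' r_lt0' VaR_level_gt0 i).
Qed.

Lemma integrable_aggregate : P.-integrable D (EFin \o at_ruin S u (aggregate S)).
Proof.
have mD : measurable D by rewrite /D aggregateE; exact: (ruin_measurable r_ hB u).
rewrite (_ : EFin \o _ = fun w => \sum_(i < d) (at_ruin S u (S i) w)%:E)%E; last first.
  by apply/funext => w; rewrite sumEFin.
by apply: integrable_sum => // i _; exact: integrable_asset.
Qed.

Lemma cond_expectation_asset i : cond_expectation P D (at_ruin S u (S i)) =
  (u * (2 * c i / s2 - r_ i / r))%:E.
Proof.
rewrite /cond_expectation -/p.
have := mean_asset_at_ruin hB s2_gt0' r_lt0' VaR_level_gt0 i.
have := mean_at_ruinE hB s2_gt0' r_lt0' VaR_level_gt0 i.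
rewrite qform_one drift_one -aggregateE => e1 e2.
rewrite {1}/D /at_ruin; move: e1; rewrite e2 => e1.
transitivity ((u * p * (2 * c i / s2 - r_ i / r))%:E * (p^-1)%:E)%E.
  by congr (_ * _)%E; exact: e1.
rewrite -EFinM; congr EFin; rewrite mulrAC -[u * p / p]mulrA divff ?mulr1//.
by rewrite gt_eqF// prob_hits_gt0.
Qed.

Lemma cond_expectation_aggregate :
  cond_expectation P D (at_ruin S u (aggregate S)) = u%:E.
Proof.
rewrite /cond_expectation -/p.
have e1 := mean_aggregate_at_ruin r_ hB VaR_level_gt0.
transitivity ((u * p)%:E * (p^-1)%:E)%E.
  congr (_ * _)%E; rewrite /p /D /at_ruin aggregateE; exact: e1.
rewrite -EFinM; congr EFin; rewrite mulfK//.
by rewrite gt_eqF// prob_hits_gt0.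
Qed.

Lemma AVaR_existsP i : AVaR_exists P S alpha i.
Proof.
rewrite /AVaR_exists VaR_aggregate; split => //; split => /=.
- by rewrite -/D prob_hitsE lte_fin prob_hits_gt0.
- exact: integrable_asset.
- exact: integrable_aggregate.
- by rewrite cond_expectation_aggregate eqe gt_eqF// VaR_level_gt0.
Qed.

(** The aggregate has conditional mean [u] at ruin, so the normalization in [Kalloc] cancels and the
    conditional mean of the asset remains. *)
Lemma AVaR_value i : AVaR P S alpha i = u * (2 * c i / s2 - r_ i / r).
Proof.
rewrite /AVaR VaR_aggregate /= /Kalloc -/D cond_expectation_asset.
rewrite cond_expectation_aggregate/=.
by rewrite mulrC divfK// gt_eqF// VaR_level_gt0.
Qed.

End gradient.

Unset Implicit Arguments.

Theorem mainTheorem6 (R : realType) (disp : measure_display)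
    (T : measurableType disp) (P : probability T R)
    (d : nat) (hd : (2 <= d)%N)
    (Sigma : 'M[R]_d) (r_ : 'I_d -> R) (B : 'I_d -> R -> T -> R)
    (hB : brownian_motion P Sigma B)
    (alpha : R) (halpha0 : 0 < alpha) (halpha1 : alpha < 1) :
  let S : 'I_d -> R -> T -> R := fun i t w => r_ i * t + B i t w in
  let r : R := \sum_(i < d) r_ i in
  let sigma2 : R := \sum_(i < d) \sum_(j < d) Sigma i j in
  0 < sigma2 -> r < 0 ->
  VaR P alpha (aggregate S) = (sigma2 / (2 * r) * ln alpha)%:E /\
  forall i : 'I_d,
    [/\ GVaR_exists P S alpha i,
        AVaR_exists P S alpha i,
        GVaR P S alpha i = AVaR P S alpha i,
        GVaR P S alpha i / fine (VaR P alpha (aggregate S)) =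
          2 * (\sum_(j < d) Sigma i j) / sigma2 - r_ i / r &
        AVaR P S alpha i / fine (VaR P alpha (aggregate S)) =
          2 * (\sum_(j < d) Sigma i j) / sigma2 - r_ i / r].
Proof.
move=> S r sigma2 s2_gt0 r_lt0.
have VaRE := VaR_aggregate hB halpha0 halpha1 s2_gt0 r_lt0.
have u_gt0 := VaR_level_gt0 halpha0 halpha1 s2_gt0 r_lt0.
split=> // i.
have GE := GVaR_value hB halpha0 halpha1 s2_gt0 r_lt0 i.
have AE := AVaR_value hB halpha0 halpha1 s2_gt0 r_lt0 i.
have u_neq0 : sigma2 / (2 * r) * ln alpha != 0 by rewrite gt_eqF.
split.
- exact: (GVaR_existsP hB halpha0 halpha1 s2_gt0 r_lt0 i).
- exact: (AVaR_existsP hB halpha0 halpha1 s2_gt0 r_lt0 i).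
- by rewrite GE AE.
- by rewrite VaRE GE mulrC mulKf.
- by rewrite VaRE AE mulrC mulKf.
Qed.
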